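(* Let $\mathscr{C}$ be a fiat category, $\mathtt{i}$ an object of $\mathscr{C}$ and $\mathcal{R}$ a right cell in $\mathcal{C}$ such that $\mathcal{R}\cap\mathcal{C}_{\mathtt{i},\mathtt{j}}\neq\varnothing$ for some object $\mathtt{j}$. For each object $\mathtt{j}$ let $\mathbf{C}_{\mathcal{R}}(\mathtt{j})$ be the full subcategory of $\mathbf{P}_{\mathtt{i}}(\mathtt{j})$ consisting of all $M$ admitting a two step resolution $X_1\to X_0\twoheadrightarrow M$ with $X_1,X_0\in\mathrm{add}(Q_{\mathcal{R},\mathtt{j}})$. Then restriction from $\mathbf{P}_{\mathtt{i}}$ (of the action of $1$-morphisms and $2$-morphisms) defines the structure of a $2$-representation of $\mathscr{C}$ on $\mathbf{C}_{\mathcal{R}}$.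
   Context: Fix an algebraically closed field $\Bbbk$. All $2$-categories are strict; functors between $\Bbbk$-linear categories (and $2$-functors) are additive and $\Bbbk$-linear. A $2$-category $\mathscr{C}$ is $\Bbbk$-finitary if (I) it has finitely many objects; (II) each $\mathscr{C}(\mathtt{i},\mathtt{j})$ is a fully additive (i.e. karoubian) $\Bbbk$-linear category with finite-dimensional morphism spaces and finitely many isomorphism classes of indecomposable objects, and horizontal composition of $1$-morphisms is biadditive; (III) every identity $1$-morphism $\mathbf{1}_{\mathtt{i}}$ is indecomposable. An involution $*$ on $\mathscr{C}$ is a lax involutive object-preserving anti-automorphism (sending $\mathrm{F}\in\mathscr{C}(\mathtt{i},\mathtt{j})$ to $\mathrm{F}^*\in\mathscr{C}(\mathtt{j},\mathtt{i})$). $\mathscr{C}$ is fiat if it is $\Bbbk$-finitary with an involution $*$ and adjunctions: for every $\mathrm{F}\in\mathscr{C}(\mathtt{i},\mathtt{j})$ there are $2$-morphisms $\alpha:\mathrm{F}\circ\mathrm{F}^*\to\mathbf{1}_{\mathtt{j}}$ and $\beta:\mathbf{1}_{\mathtt{i}}\to\mathrm{F}^*\circ\mathrm{F}$ with $\alpha_{\mathrm{F}}\circ_1\mathrm{F}(\beta)=\mathrm{id}_{\mathrm{F}}$ and $\mathrm{F}^*(\alpha)\circ_1\beta_{\mathrm{F}^*}=\mathrm{id}_{\mathrm{F}^*}$, where $\circ_0,\circ_1$ are horizontal and vertical composition, $\mathrm{F}(\beta)=\mathrm{id}_{\mathrm{F}}\circ_0\beta$, $\alpha_{\mathrm{F}}=\alpha\circ_0\mathrm{id}_{\mathrm{F}}$.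 $\mathfrak{R}_{\Bbbk}$ is the $2$-category whose objects are categories equivalent to module categories of finite-dimensional $\Bbbk$-algebras, $1$-morphisms are functors, $2$-morphisms are natural transformations. A $2$-representation of $\mathscr{C}$ is a strict $2$-functor $\mathbf{M}:\mathscr{C}\to\mathfrak{R}_{\Bbbk}$; write $\mathrm{F}\,X$ for $\mathbf{M}(\mathrm{F})(X)$. $\overline{\mathscr{C}}(\mathtt{i},\mathtt{j})$ has as objects the diagrams $\mathrm{F}\overset{\alpha}{\to}\mathrm{G}$ with $\alpha$ a $2$-morphism in $\mathscr{C}(\mathtt{i},\mathtt{j})$; morphisms from $\mathrm{F}\overset{\alpha}{\to}\mathrm{G}$ to $\mathrm{F}'\overset{\alpha'}{\to}\mathrm{G}'$ are pairs $(\beta:\mathrm{F}\to\mathrm{F}',\beta':\mathrm{G}\to\mathrm{G}')$ with $\beta'\alpha=\alpha'\beta$, modulo those for which there is $\xi:\mathrm{G}\to\mathrm{F}'$ with $\alpha'\xi=\beta'$. This is an abelian category equivalent to the module category of a finite-dimensional algebra. $\mathbf{P}_{\mathtt{i}}$ is the $2$-representation with $\mathbf{P}_{\mathtt{i}}(\mathtt{j})=\overline{\mathscr{C}}(\mathtt{i},\mathtt{j})$, where $1$- and $2$-morphisms act by left horizontal composition. For $\mathrm{F}\in\mathscr{C}(\mathtt{i},\mathtt{j})$, $P_{\mathrm{F}}$ is the projective object $0\to\mathrm{F}$; for $\mathrm{F}$ indecomposable, $L_{\mathrm{F}}$ is its unique simple quotient. $\mathcal{C}_{\mathtt{i},\mathtt{j}}$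 is a complete set of pairwise non-isomorphic indecomposable objects of $\mathscr{C}(\mathtt{i},\mathtt{j})$ and $\mathcal{C}=\bigcup_{\mathtt{i},\mathtt{j}}\mathcal{C}_{\mathtt{i},\mathtt{j}}$. For $\mathrm{F},\mathrm{G}\in\mathcal{C}$ write $\mathrm{F}\leq_R\mathrm{G}$ if $\mathrm{G}$ is a direct summand of $\mathrm{H}\circ\mathrm{F}$ for some $1$-morphism $\mathrm{H}$. The equivalence classes of this preorder are the right cells (all elements of a right cell have the same source object). For $\mathcal{R}$ and $\mathtt{i}$ as in the claim there is a unique submodule $K_{\mathcal{R}}$ of $P_{\mathbf{1}_{\mathtt{i}}}$ such that every simple subquotient of $P_{\mathbf{1}_{\mathtt{i}}}/K_{\mathcal{R}}$ is annihilated by every $\mathrm{F}\in\mathcal{R}$ and $K_{\mathcal{R}}$ has simple top $L_{\mathrm{G}_{\mathcal{R}}}$ for some $\mathrm{G}_{\mathcal{R}}\in\mathcal{C}$ with $\mathrm{F}\,L_{\mathrm{G}_{\mathcal{R}}}\neq0$ for all $\mathrm{F}\in\mathcal{R}$; this defines $\mathrm{G}_{\mathcal{R}}$. Put $Q_{\mathcal{R},\mathtt{j}}=\bigoplus_{\mathrm{F}\in\mathcal{R}\cap\mathcal{C}_{\mathtt{i},\mathtt{j}}}\mathrm{F}\,L_{\mathrm{G}_{\mathcal{R}}}$; a two step resolution is an exact sequence $X_1\to X_0\to M\to0$. *)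

(* Defs.v *)
From HB Require Import structures.
From mathcomp Require Import all_boot all_algebra.
From mathcomp Require Import boolp classical_sets cardinality.

Set Implicit Arguments.
Unset Strict Implicit.
Unset Printing Implicit Defensive.

Import GRing.Theory.
Local Open Scope ring_scope.
Local Open Scope quotient_scope.

Section Subquotients.
Variables (k : fieldType) (V : lmodType k).

Record submod := Submod {
  submod_pred :> V -> Prop;
  submod0 : submod_pred 0;
  submodZD : forall (c : k) u v,
    submod_pred u -> submod_pred v -> submod_pred (c *: u + v) }.

Variable P : submod.

Definition submod_mem : {pred V} := fun v => `[< P v >].

Fact submod_memP : submod_closed submod_mem.
Proof.
split=> [|c u v /asboolP Pu /asboolP Pv]; apply/asboolP; first exact: submod0.
exact: submodZD.
Qed.

HB.instance Definition _ := GRing.isSubmodClosed.Build k V submod_mem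
  (GRing.submod_closed_semi submod_memP).

Record lsub := LSub { lval :> V; lvalP : lval \in submod_mem }.
HB.instance Definition _ := [isSub for lval].
HB.instance Definition _ := [Choice of lsub by <:].
HB.instance Definition _ := [SubChoice_isSubLmodule of lsub by <:].

Definition lquot := Quotient.quot submod_mem.
HB.instance Definition _ := GRing.Zmodule.on lquot.
HB.instance Definition _ := EqQuotient.on lquot.

Definition lcls (v : V) : lquot := \pi_lquot v.

Lemma lcls_eq u v : lcls u = lcls v <-> P (u - v).
Proof.
have E : (lcls u == lcls v) = (u - v \in submod_mem).
  by rewrite /lcls -Quotient.idealrBE.
by split=> [/eqP|Puv]; [|apply/eqP]; rewrite E; [move/asboolP | apply/asboolP].
Qed.

Lemma lcls_surj (q : lquot) : exists v, q = lcls v.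
Proof. by exists (repr q); rewrite /lcls reprK. Qed.

Lemma lclsD u v : lcls (u + v) = lcls u + lcls v.
Proof. by rewrite /lcls !piE. Qed.

Definition lquot_scale (c : k) (q : lquot) : lquot := lcls (c *: repr q).

Lemma lclsZ c v : lcls (c *: v) = lquot_scale c (lcls v).
Proof.
apply/lcls_eq; rewrite -scalerBr -[_ *: _]addr0; apply: submodZD; last exact: submod0.
by apply/lcls_eq; rewrite {2}/lcls reprK.
Qed.

Fact lquot_scalerA a b v :
  lquot_scale a (lquot_scale b v) = lquot_scale (a * b) v.
Proof. by have [w ->] := lcls_surj v; rewrite -!lclsZ scalerA. Qed.
Fact lquot_scale1r : left_id 1 lquot_scale.
Proof. by move=> v; have [w ->] := lcls_surj v; rewrite -!lclsZ scale1r. Qed.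
Fact lquot_scalerDr : right_distributive lquot_scale +%R.
Proof.
move=> a u v; have [u' ->] := lcls_surj u; have [v' ->] := lcls_surj v.
by rewrite -!lclsZ -!lclsD -lclsZ scalerDr.
Qed.
Fact lquot_scalerDl v : {morph lquot_scale^~ v : a b / a + b}.
Proof.
by move=> a b; have [w ->] := lcls_surj v; rewrite -!lclsZ -lclsD scalerDl.
Qed.
HB.instance Definition _ := GRing.Zmodule_isLmodule.Build k lquot
  lquot_scalerA lquot_scale1r lquot_scalerDr lquot_scalerDl.

Lemma lcls_linear : linear lcls.
Proof. by move=> c u v; rewrite lclsD lclsZ. Qed.

End Subquotients.

Declare Scope lincat_scope.
Delimit Scope lincat_scope with lincat.
Local Open Scope lincat_scope.

Reserved Notation "g \c f" (at level 41, right associativity).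
Reserved Notation "F \o1 G" (at level 40, left associativity).
Reserved Notation "a \o2 b" (at level 40, left associativity).

Section LinearCategories.
Variable k : fieldType.

Record lincat := LinCat {
  obj :> Type;
  hom : obj -> obj -> lmodType k;
  idm : forall x, hom x x;
  mcomp : forall x y z, hom y z -> hom x y -> hom x z;
  mcompA : forall x y z t (h : hom z t) (g : hom y z) (f : hom x y),
    mcomp h (mcomp g f) = mcomp (mcomp h g) f;
  mcomp1m : forall x y (f : hom x y), mcomp (idm y) f = f;
  mcompm1 : forall x y (f : hom x y), mcomp f (idm x) = f;
  mcomp_linl : forall x y z (f : hom x y),
    linear (fun g : hom y z => mcomp g f);
  mcomp_linr : forall x y z (g : hom y z),
    linear (fun f : hom x y => mcomp g f) }.

End LinearCategories.

Arguments hom {k _} _ _.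
Arguments idm {k _} _.
Arguments mcomp {k _ _ _ _} _ _.
Notation "g \c f" := (mcomp g f) : lincat_scope.

Section CategoryTheory.
Variables (k : fieldType) (A : lincat k).
Implicit Types x y z : A.

(* The identity of [x], seen as a morphism [x -> y] along [x = y]; it is how *)
(* all strict equalities between 1-morphisms are compared below.             *)
Definition eqm x y (e : x = y) : hom x y :=
  match e in _ = y' return hom x y' with erefl => idm x end.

Definition is_iso x y (f : hom x y) :=
  exists g : hom y x, g \c f = idm x /\ f \c g = idm y.

Definition isomorphic x y := exists f : hom x y, is_iso f.

Definition mono x y (f : hom x y) :=
  forall z (u v : hom z x), f \c u = f \c v -> u = v.

Definition epi x y (f : hom x y) :=
  forall z (u v : hom y z), u \c f = v \c f -> u = v.

Definition is_zero x := idm x = 0.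

Definition is_dsum (I : finType) (x : I -> A) (y : A) :=
  exists (inj : forall a, hom (x a) y) (prj : forall a, hom y (x a)),
  [/\ forall a, prj a \c inj a = idm (x a),
      forall a b, a != b -> prj b \c inj a = 0
    & \sum_(a : I) inj a \c prj a = idm y].

Definition is_dsum2 x y z := is_dsum (fun b : bool => if b then x else y) z.

Definition summand x y := exists x', is_dsum2 x x' y.

Definition indecomposable x :=
  ~ is_zero x /\ forall y z, is_dsum2 y z x -> is_zero y \/ is_zero z.

Definition in_add (q x : A) :=
  exists n y, is_dsum (fun _ : 'I_n => q) y /\ summand x y.

Definition fully_additive :=
  [/\ exists z, is_zero z,
      forall x y, exists z, is_dsum2 x y z
    & forall x (e : hom x x), e \c e = e ->
        exists y (p : hom x y) (i : hom y x), p \c i = idm y /\ i \c p = e].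

Definition fin_dim (V : lmodType k) := exists n, inhabited (Vector.axiom n V).

Definition finitary_cat :=
  [/\ fully_additive,
      forall x y, fin_dim (hom x y)
    & exists n (s : 'I_n -> A),
        forall x, indecomposable x -> exists a, isomorphic x (s a)].

Definition is_kernel x y z (f : hom y z) (i : hom x y) :=
  f \c i = 0 /\
  forall t (u : hom t y), f \c u = 0 -> exists! v : hom t x, i \c v = u.

Definition is_cokernel x y z (f : hom x y) (p : hom y z) :=
  p \c f = 0 /\
  forall t (u : hom y t), u \c f = 0 -> exists! v : hom z t, v \c p = u.

(* The image of [f] is the kernel of [g]. *)
Definition exact_at x y z (f : hom x y) (g : hom y z) :=
  exists n (i : hom n y) (f' : hom x n),
    [/\ is_kernel g i, i \c f' = f & epi f'].

Definition simple x :=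
  ~ is_zero x /\
  forall y (u : hom y x), mono u -> is_zero y \/ is_iso u.

Definition subquotient s x :=
  exists y (u : hom y x) (q : hom y s), mono u /\ epi q.

Definition unique_simple_quotient p l :=
  simple l /\ exists q : hom p l, epi q /\
  forall l' (q' : hom p l'), simple l' -> epi q' ->
    exists u : hom l l', is_iso u /\ u \c q = q'.

Definition maximal_sub m x (i : hom m x) :=
  [/\ mono i, ~ is_iso i
    & forall y (u : hom y x) (v : hom m y),
        mono u -> u \c v = i -> is_iso u \/ is_iso v].

Definition factors_through y z x (u : hom y x) (i : hom z x) :=
  exists v : hom y z, i \c v = u.

(* The intersection of all maximal subobjects. *)
Definition is_radical n x (r : hom n x) :=
  [/\ mono r,
      forall m (i : hom m x), maximal_sub i -> factors_through r i
    & forall y (u : hom y x), mono u ->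
        (forall m (i : hom m x), maximal_sub i -> factors_through u i) ->
        factors_through u r].

Definition has_simple_top x l :=
  simple l /\ exists n (r : hom n x) (p : hom x l),
    is_radical r /\ is_cokernel r p.

(* A zero object (and [x] itself in the degenerate case when none exists). *)
Definition zero_obj x : A :=
  if pselect (exists z : A, is_zero z) is left h then sval (cid h) else x.

End CategoryTheory.

Section Functors.
Variable k : fieldType.

Record functor (A B : lincat k) := Functor {
  fob :> A -> B;
  fmap : forall x y, hom x y -> hom (fob x) (fob y);
  fmap_lin : forall x y, linear (@fmap x y);
  fmap1 : forall x, fmap (idm x) = idm (fob x);
  fmapM : forall x y z (g : hom y z) (f : hom x y),
    fmap (g \c f) = fmap g \c fmap f }.

Definition natural (A B : lincat k) (F G : functor A B)
    (t : forall x, hom (F x) (G x)) :=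
  forall x y (f : hom x y), t y \c fmap F f = fmap G f \c t x.

Definition quasi_inverse (A B : lincat k) (F : functor A B) (G : functor B A) :=
  exists t : forall x, hom (G (F x)) x,
    (forall x, is_iso (t x)) /\
    forall x y (f : hom x y), t y \c fmap G (fmap F f) = f \c t x.

Definition equivalent (A B : lincat k) :=
  exists (F : functor A B) (G : functor B A),
    quasi_inverse F G /\ quasi_inverse G F.

Section FullSub.
Variables (A : lincat k) (S : A -> Prop).

Definition full_sub : lincat k.
Proof.
exists {x : A | S x} (fun x y => hom (sval x) (sval y)) (fun x => idm (sval x))
  (fun x y z g f => g \c f).
- by move=> *; exact: mcompA.
- by move=> *; exact: mcomp1m.
- by move=> *; exact: mcompm1.
- by move=> *; exact: mcomp_linl.
- by move=> *; exact: mcomp_linr.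
Defined.

End FullSub.
End Functors.

Section ModuleCategories.
Variable k : fieldType.

(* Unlike [falgType k], this allows the zero algebra. *)
Record fdalg := FdAlg {
  alg_car :> vectType k;
  alg_one : alg_car;
  alg_mul : alg_car -> alg_car -> alg_car;
  alg_mulA : associative alg_mul;
  alg_mul1 : left_id alg_one alg_mul;
  alg_mulr1 : right_id alg_one alg_mul;
  alg_linl : forall b, linear (fun a => alg_mul a b);
  alg_linr : forall a, linear (alg_mul a) }.

Variable A : fdalg.

Record fdmod := FdMod {
  mod_car :> vectType k;
  act : A -> mod_car -> mod_car;
  act_linl : forall v, linear (fun a => act a v);
  act_linr : forall a, linear (act a);
  act1 : forall v, act (alg_one A) v = v;
  actM : forall a b v, act (alg_mul a b) v = act a (act b v) }.

Section ModHom.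
Variables V W : fdmod.

Definition mod_equivariant (f : 'Hom(V, W)) :=
  forall a v, f (act a v) = act a (f v).

Fact mod_equivariant0 : mod_equivariant 0.
Proof.
move=> a v; rewrite !lfunE /=.
by have := act_linr a (-1) 0 (0 : W); rewrite scaler0 addr0 scaleN1r addNr.
Qed.

Fact mod_equivariantZD (c : k) f g :
  mod_equivariant f -> mod_equivariant g -> mod_equivariant (c *: f + g).
Proof. by move=> hf hg a v; rewrite !lfunE /= !lfunE /= hf hg act_linr. Qed.

Definition mod_hom : lmodType k :=
  lsub (Submod mod_equivariant0 mod_equivariantZD).

Definition ModHom f (h : mod_equivariant f) : mod_hom :=
  LSub (asboolT h : f \in submod_mem (Submod mod_equivariant0 mod_equivariantZD)).

Lemma mod_homP (f : mod_hom) : mod_equivariant (lval f).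
Proof. exact: asboolW (lvalP f). Qed.

End ModHom.

Fact mod_id_subproof (V : fdmod) : mod_equivariant (\1%VF : 'Hom(V, V)).
Proof. by move=> a v; rewrite !id_lfunE. Qed.

Fact mod_comp_subproof (V W U : fdmod) (g : mod_hom W U) (f : mod_hom V W) :
  mod_equivariant (lval g \o lval f)%VF.
Proof. by move=> a v; rewrite !comp_lfunE !mod_homP. Qed.

Definition modcat : lincat k.
Proof.
exists fdmod mod_hom (fun V => ModHom (@mod_id_subproof V))
  (fun V W U g f => ModHom (mod_comp_subproof g f)).
- by move=> *; apply: val_inj; rewrite /= comp_lfunA.
- by move=> *; apply: val_inj; rewrite /= comp_lfun1l.
- by move=> *; apply: val_inj; rewrite /= comp_lfun1r.
- by move=> V W U f c g h; apply: val_inj; rewrite /= comp_lfunDl comp_lfunZl.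
- by move=> V W U f c g h; apply: val_inj; rewrite /= comp_lfunDr comp_lfunZr.
Defined.

End ModuleCategories.

(* Membership in R_k: equivalent to the finite-dimensional modules over some *)
(* finite-dimensional algebra, which may be zero.                            *)
Definition module_category_like (k : fieldType) (C : lincat k) :=
  exists A : fdalg k, equivalent C (modcat A).

Section Abelianisation.
Variables (k : fieldType) (A : lincat k).

Record aobj := AObj { asrc : A; atgt : A; amor : hom asrc atgt }.

Section Hom.
Variables X Y : aobj.

Definition asquare (p : hom (asrc X) (asrc Y) * hom (atgt X) (atgt Y)) :=
  p.2 \c amor X = amor Y \c p.1.

Fact asquare0 : asquare 0.
Proof.
have l0 := mcomp_linl (amor X) (-1) 0 (0 : hom (atgt X) (atgt Y)).
have r0 := mcomp_linr (amor Y) (-1) 0 (0 : hom (asrc X) (asrc Y)).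
rewrite /asquare /=; move: l0 r0.
by rewrite !scaler0 !addr0 !scaleN1r !addNr => -> ->.
Qed.

Fact asquareZD (c : k) p q : asquare p -> asquare q -> asquare (c *: p + q).
Proof. by rewrite /asquare /= mcomp_linl mcomp_linr => -> ->. Qed.

Definition asquares := Submod asquare0 asquareZD.

Definition anull (p : lsub asquares) :=
  exists xi : hom (atgt X) (asrc Y), amor Y \c xi = (lval p).2.

Fact anull0 : anull 0.
Proof.
exists 0; have := mcomp_linr (amor Y) (-1) 0 (0 : hom (atgt X) (asrc Y)).
by rewrite !scaler0 !addr0 !scaleN1r !addNr => ->.
Qed.

Fact anullZD (c : k) p q : anull p -> anull q -> anull (c *: p + q).
Proof.
by move=> [u hu] [v hv]; exists (c *: u + v); rewrite mcomp_linr hu hv.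
Qed.

Definition anulls := Submod anull0 anullZD.

Definition ahom : lmodType k := lquot anulls.

Definition ASq b b' (h : asquare (b, b')) : lsub asquares :=
  LSub (asboolT h : (b, b') \in submod_mem asquares).

Lemma asqP (p : lsub asquares) : asquare (lval p).
Proof. exact: asboolW (lvalP p). Qed.

Definition acls (p : lsub asquares) : ahom := lcls anulls p.

Lemma acls_surj (f : ahom) : exists p, f = acls p.
Proof. exact: lcls_surj. Qed.

Lemma acls_eq p q : acls p = acls q <->
  exists xi, amor Y \c xi = (lval p).2 - (lval q).2.
Proof. exact: lcls_eq. Qed.

Lemma acls_ext p q :
  (lval p).1 = (lval q).1 -> (lval p).2 = (lval q).2 -> acls p = acls q.
Proof.
move=> e1 e2; congr acls; apply: val_inj.
by rewrite /= [LHS]surjective_pairing e1 e2 -surjective_pairing.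
Qed.

End Hom.

Fact aid_subproof X : asquare (idm (asrc X), idm (atgt X)).
Proof. by rewrite /asquare /= mcomp1m mcompm1. Qed.
Definition aid X : ahom X X := acls (ASq (aid_subproof X)).

Fact asq_comp_subproof X Y Z
    (q : lsub (asquares Y Z)) (p : lsub (asquares X Y)) :
  asquare ((lval q).1 \c (lval p).1, (lval q).2 \c (lval p).2).
Proof.
rewrite /asquare /= -mcompA (asqP p : _ \c _ = _ \c _) !mcompA.
by rewrite (asqP q : _ \c _ = _ \c _).
Qed.
Definition asq_comp X Y Z q p := ASq (@asq_comp_subproof X Y Z q p).

Definition acomp X Y Z (g : ahom Y Z) (f : ahom X Y) : ahom X Z :=
  acls (asq_comp (repr g) (repr f)).

Lemma mcompBl x y z (g h : hom y z) (f : hom x y) :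
  (g - h) \c f = g \c f - h \c f :> hom (x : A) z.
Proof. by have := mcomp_linl f (-1) h g; rewrite !scaleN1r ![- _ + _]addrC. Qed.

Lemma mcompBr x y z (g : hom y z) (f h : hom x y) :
  g \c (f - h) = g \c f - g \c h :> hom (x : A) z.
Proof. by have := mcomp_linr g (-1) h f; rewrite !scaleN1r ![- _ + _]addrC. Qed.

Lemma acompE X Y Z (q : lsub (asquares Y Z)) (p : lsub (asquares X Y)) :
  acomp (acls q) (acls p) = acls (asq_comp q p).
Proof.
have rP (U V : aobj) (f : lsub (asquares U V)) : acls (repr (acls f)) = acls f.
  by rewrite /acls /lcls reprK.
have /acls_eq[u hu] := rP _ _ q; have /acls_eq[v hv] := rP _ _ p.
apply/acls_eq => /=.
move: (repr (acls q)) (repr (acls p)) hu hv => q' p' hu hv.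
exists (u \c (lval p').2 + (lval q).1 \c v).
have -> : forall a b, amor Z \c (a + b) = amor Z \c a + amor Z \c b.
  by move=> X' a b; have := mcomp_linr (amor Z) 1 a b; rewrite !scale1r.
rewrite !mcompA hu -(asqP q : _ \c _ = _ \c _) -mcompA hv mcompBl mcompBr.
by rewrite addrA subrK.
Qed.

(* Objects: 2-morphisms [asrc -> atgt]; morphisms: commutative squares modulo *)
(* those whose second component factors through the target diagram.          *)
Definition abar : lincat k.
Proof.
exists aobj ahom aid acomp.
- move=> X Y Z T h g f; have [p ->] := acls_surj f.
  have [q ->] := acls_surj g; have [r ->] := acls_surj h.
  by rewrite !acompE; apply: acls_ext; rewrite /= mcompA.
- move=> X Y f; have [p ->] := acls_surj f.
  by rewrite acompE; apply: acls_ext; rewrite /= mcomp1m.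
- move=> X Y f; have [p ->] := acls_surj f.
  by rewrite acompE; apply: acls_ext; rewrite /= mcompm1.
- move=> X Y Z f c g h; have [p ->] := acls_surj f.
  have [q ->] := acls_surj g; have [r ->] := acls_surj h.
  rewrite /acls -lcls_linear !acompE -lcls_linear.
  by apply: acls_ext; rewrite /= mcomp_linl.
- move=> X Y Z f c g h; have [p ->] := acls_surj f.
  have [q ->] := acls_surj g; have [r ->] := acls_surj h.
  rewrite /acls -lcls_linear !acompE -lcls_linear.
  by apply: acls_ext; rewrite /= mcomp_linr.
Defined.

Definition Proj (F : A) : abar := AObj (0 : hom (zero_obj F) F).

Definition is_simple_head (F : A) (L : abar) := unique_simple_quotient (Proj F) L.

End Abelianisation.

Section AbelianisedFunctors.
Variables (k : fieldType) (A B : lincat k).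

Section Fun.
Variable F : functor A B.

Definition afob (X : abar A) : abar B := AObj (fmap F (amor X)).

Fact asq_map_subproof X Y (p : lsub (asquares X Y)) :
  @asquare k B (afob X) (afob Y) (fmap F (lval p).1, fmap F (lval p).2).
Proof. by rewrite /asquare /= -!fmapM (asqP p : _ \c _ = _ \c _). Qed.
Definition asq_map X Y p := ASq (@asq_map_subproof X Y p).

Definition afmap (X Y : abar A) (f : hom X Y) : hom (afob X) (afob Y) :=
  acls (asq_map (repr (f : ahom X Y))).

Lemma afmapE X Y (p : lsub (asquares X Y)) :
  afmap (acls p : hom (X : abar A) Y) = acls (asq_map p).
Proof.
have /acls_eq[u hu] : acls (repr (acls p)) = acls p by rewrite /acls /lcls reprK.
apply/acls_eq => /=; exists (fmap F u); rewrite -fmapM hu addrC -scaleN1r.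
by rewrite fmap_lin scaleN1r addrC.
Qed.

Definition afun : functor (abar A) (abar B).
Proof.
exists afob afmap.
- move=> X Y c f g; have [p ->] := acls_surj f; have [q ->] := acls_surj g.
  rewrite /acls -lcls_linear !afmapE -lcls_linear.
  by apply: acls_ext; rewrite /= fmap_lin.
- by move=> X; rewrite [LHS]afmapE; apply: acls_ext; rewrite /= fmap1.
- move=> X Y Z g f; have [p ->] := acls_surj f; have [q ->] := acls_surj g.
  rewrite [_ \c _]acompE !afmapE [RHS]acompE.
  by apply: acls_ext; rewrite /= fmapM.
Defined.

End Fun.

Section Nat.
Variables (F G : functor A B) (t : forall x, hom (F x) (G x)).
Hypothesis nat_t : natural t.

Fact asq_nat_subproof (X : abar A) :
  @asquare k B (afun F X) (afun G X) (t (asrc X), t (atgt X)).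
Proof. by rewrite /asquare /= nat_t. Qed.
Definition asq_nat X := ASq (asq_nat_subproof X).

Definition anat (X : abar A) : hom (afun F X) (afun G X) := acls (asq_nat X).

Lemma anat_natural : natural anat.
Proof.
move=> X Y f; have [p ->] := acls_surj f.
rewrite /anat /= !afmapE [LHS]acompE [RHS]acompE.
by apply: (@acls_ext _ _ (afob F X) (afob G Y)); rewrite /= nat_t.
Qed.

End Nat.
End AbelianisedFunctors.

Section TwoCategories.
Variable k : fieldType.

(* A strict k-linear 2-category. Strict associativity and unitality consist  *)
(* of equalities of 1-morphisms, together with the compatibility of [hcomp2] *)
(* with these equalities.                                                    *)
Record twocat := TwoCat {
  ob :> Type;
  onecat :> ob -> ob -> lincat k;
  one1 : forall i, onecat i i;
  comp1 : forall i j l, onecat j l -> onecat i j -> onecat i l;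
  hcomp2 : forall i j l (F F' : onecat j l) (G G' : onecat i j),
    hom F F' -> hom G G' -> hom (comp1 F G) (comp1 F' G');
  hcomp2_linl : forall i j l (F F' : onecat j l) (G G' : onecat i j)
    (b : hom G G'), linear (fun a : hom F F' => hcomp2 a b);
  hcomp2_linr : forall i j l (F F' : onecat j l) (G G' : onecat i j)
    (a : hom F F'), linear (fun b : hom G G' => hcomp2 a b);
  hcomp2_id : forall i j l (F : onecat j l) (G : onecat i j),
    hcomp2 (idm F) (idm G) = idm (comp1 F G);
  interchange : forall i j l (F F' F'' : onecat j l) (G G' G'' : onecat i j)
    (a' : hom F' F'') (a : hom F F') (b' : hom G' G'') (b : hom G G'),
    hcomp2 (a' \c a) (b' \c b) = hcomp2 a' b' \c hcomp2 a b;
  comp1A : forall i j l m (F : onecat l m) (G : onecat j l) (H : onecat i j),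
    comp1 F (comp1 G H) = comp1 (comp1 F G) H;
  comp1_1l : forall i j (F : onecat i j), comp1 (one1 j) F = F;
  comp1_1r : forall i j (F : onecat i j), comp1 F (one1 i) = F;
  hcomp2A : forall i j l m (F F' : onecat l m) (G G' : onecat j l)
    (H H' : onecat i j) (a : hom F F') (b : hom G G') (c : hom H H'),
    eqm (comp1A F' G' H') \c hcomp2 a (hcomp2 b c)
    = hcomp2 (hcomp2 a b) c \c eqm (comp1A F G H);
  hcomp2_1l : forall i j (F F' : onecat i j) (a : hom F F'),
    eqm (comp1_1l F') \c hcomp2 (idm (one1 j)) a = a \c eqm (comp1_1l F);
  hcomp2_1r : forall i j (F F' : onecat i j) (a : hom F F'),
    eqm (comp1_1r F') \c hcomp2 a (idm (one1 i)) = a \c eqm (comp1_1r F) }.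

End TwoCategories.

Arguments one1 {k _} _.
Arguments comp1 {k _ _ _ _} _ _.
Arguments hcomp2 {k _ _ _ _ _ _ _ _} _ _.
Notation "F \o1 G" := (comp1 F G) : lincat_scope.
Notation "a \o2 b" := (hcomp2 a b) : lincat_scope.

Section Fiat.
Variables (k : fieldType) (C : twocat k).

Definition finitary :=
  [/\ finite_set [set: ob C],
      forall i j : C, finitary_cat (C i j)
    & forall i : C, indecomposable (one1 i)].

(* Reverses both 1- and 2-morphisms; it is compatible with composition and   *)
(* involutive only up to coherent isomorphisms [inv_mu], [inv_eps], [inv_eta]. *)
Record involution := Involution {
  inv : forall i j : C, C i j -> C j i;
  inv2 : forall (i j : C) (F G : C i j), hom F G -> hom (inv G) (inv F);
  inv2_lin : forall (i j : C) (F G : C i j), linear (@inv2 i j F G);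
  inv2_id : forall (i j : C) (F : C i j), inv2 (idm F) = idm (inv F);
  inv2_comp : forall (i j : C) (F G H : C i j) (b : hom G H) (a : hom F G),
    inv2 (b \c a) = inv2 a \c inv2 b;
  inv_mu : forall (i j l : C) (F : C j l) (G : C i j),
    hom (inv G \o1 inv F) (inv (F \o1 G));
  inv_mu_iso : forall (i j l : C) (F : C j l) (G : C i j), is_iso (inv_mu F G);
  inv_mu_nat : forall (i j l : C) (F F' : C j l) (G G' : C i j)
    (a : hom F F') (b : hom G G'),
    inv2 (a \o2 b) \c inv_mu F' G' = inv_mu F G \c (inv2 b \o2 inv2 a);
  inv_eps : forall i : C, hom (one1 i) (inv (one1 i));
  inv_eps_iso : forall i : C, is_iso (inv_eps i);
  inv_mu_assoc : forall (i j l m : C) (F : C l m) (G : C j l) (H : C i j),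
    eqm (congr1 (@inv i m) (comp1A F G H)) \c inv_mu F (G \o1 H)
      \c (inv_mu G H \o2 idm (inv F)) \c eqm (comp1A (inv H) (inv G) (inv F))
    = inv_mu (F \o1 G) H \c (idm (inv H) \o2 inv_mu F G);
  inv_mu_1l : forall (i j : C) (F : C i j),
    eqm (congr1 (@inv i j) (comp1_1l F)) \c inv_mu (one1 j) F
      \c (idm (inv F) \o2 inv_eps j)
    = eqm (comp1_1r (inv F));
  inv_mu_1r : forall (i j : C) (F : C i j),
    eqm (congr1 (@inv i j) (comp1_1r F)) \c inv_mu F (one1 i)
      \c (inv_eps i \o2 idm (inv F))
    = eqm (comp1_1l (inv F));
  inv_eta : forall (i j : C) (F : C i j), hom F (inv (inv F));
  inv_eta_iso : forall (i j : C) (F : C i j), is_iso (inv_eta F);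
  inv_eta_nat : forall (i j : C) (F G : C i j) (a : hom F G),
    inv2 (inv2 a) \c inv_eta F = inv_eta G \c a;
  inv_eta_mu : forall (i j l : C) (F : C j l) (G : C i j),
    inv_mu (inv G) (inv F) \c (inv_eta F \o2 inv_eta G)
    = inv2 (inv_mu F G) \c inv_eta (F \o1 G);
  inv_eta_eps : forall i : C,
    inv2 (inv_eps i) \c inv_eta (one1 i) = inv_eps i }.

Definition adjunction (i j : C) (F : C i j) (F' : C j i)
    (alpha : hom (F \o1 F') (one1 j)) (beta : hom (one1 i) (F' \o1 F)) :=
  eqm (comp1_1l F) \c (alpha \o2 idm F) \c eqm (comp1A F F' F)
    \c (idm F \o2 beta) = eqm (comp1_1r F)
  /\
  eqm (comp1_1r F') \c (idm F' \o2 alpha) \c eqm (esym (comp1A F' F F'))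
    \c (beta \o2 idm F') = eqm (comp1_1l F').

Definition fiat (star : involution) :=
  finitary /\
  forall (i j : C) (F : C i j), exists alpha beta,
    @adjunction i j F (inv star F) alpha beta.

End Fiat.

Section TwoFunctors.
Variables (k : fieldType) (C : twocat k).

Record twofunctor := TwoFunctor {
  tf0 :> C -> lincat k;
  tf1 : forall i j : C, C i j -> functor (tf0 i) (tf0 j);
  tf2 : forall (i j : C) (F G : C i j), hom F G ->
    forall X : tf0 i, hom (tf1 F X) (tf1 G X);
  tf2_nat : forall (i j : C) (F G : C i j) (a : hom F G), natural (tf2 a);
  tf2_lin : forall (i j : C) (F G : C i j) (c : k) (a b : hom F G) X,
    tf2 (c *: a + b) X = c *: tf2 a X + tf2 b X;
  tf2_id : forall (i j : C) (F : C i j) X, tf2 (idm F) X = idm (tf1 F X);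
  tf2_comp : forall (i j : C) (F G H : C i j) (b : hom G H) (a : hom F G) X,
    tf2 (b \c a) X = tf2 b X \c tf2 a X;
  tf1_comp : forall (i j l : C) (F : C j l) (G : C i j) X,
    tf1 (F \o1 G) X = tf1 F (tf1 G X);
  tf1_compM : forall (i j l : C) (F : C j l) (G : C i j) X Y (f : hom X Y),
    eqm (tf1_comp F G Y) \c fmap (tf1 (F \o1 G)) f
    = fmap (tf1 F) (fmap (tf1 G) f) \c eqm (tf1_comp F G X);
  tf1_one : forall (i : C) X, tf1 (one1 i) X = X;
  tf1_oneM : forall (i : C) X Y (f : hom X Y),
    eqm (tf1_one Y) \c fmap (tf1 (one1 i)) f = f \c eqm (tf1_one X);
  tf2_hcomp : forall (i j l : C) (F F' : C j l) (G G' : C i j)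
    (a : hom F F') (b : hom G G') X,
    eqm (tf1_comp F' G' X) \c tf2 (a \o2 b) X
    = (tf2 a (tf1 G' X) \c fmap (tf1 F) (tf2 b X)) \c eqm (tf1_comp F G X) }.

Definition is_2representation (M : twofunctor) :=
  forall i : C, module_category_like (M i).

Definition stable (M : twofunctor) (S : forall i : C, M i -> Prop) :=
  forall (i j : C) (F : C i j) (X : M i), S i X -> S j (tf1 M F X).

Section Restriction.
Variables (M : twofunctor) (S : forall i : C, M i -> Prop) (hS : stable S).

Definition res0 (i : C) := full_sub (@S i).

Definition res1 (i j : C) (F : C i j) : functor (res0 i) (res0 j).
Proof.
exists (fun X => exist _ (tf1 M F (sval X)) (hS F (svalP X)))
  (fun X Y f => fmap (tf1 M F) f).
- by move=> X Y; exact: (@fmap_lin _ _ _ (tf1 M F) (sval X) (sval Y)).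
- by move=> *; exact: fmap1.
- by move=> *; exact: fmapM.
Defined.

Definition res2 (i j : C) (F G : C i j) (a : hom F G) (X : res0 i) :
  hom (res1 F X) (res1 G X) := tf2 a (sval X).

Lemma eqm_sval i (X Y : res0 i) (e : X = Y) (e' : sval X = sval Y) :
  eqm e = eqm e' :> hom (sval X) (sval Y).
Proof. by case: _ / e e' => e'; rewrite (Prop_irrelevance e' erefl). Qed.

Fact res1_comp (i j l : C) (F : C j l) (G : C i j) (X : res0 i) :
  res1 (F \o1 G) X = res1 F (res1 G X).
Proof. by apply: eq_exist; exact: tf1_comp. Qed.

Fact res1_one (i : C) (X : res0 i) : res1 (one1 i) X = X.
Proof. by case: X => X hX; apply: eq_exist; exact: tf1_one. Qed.

Definition restrict : twofunctor.
Proof.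
apply: (@TwoFunctor res0 res1 res2 _ _ _ _ res1_comp _ res1_one).
- by move=> i j F G a X Y f; exact: tf2_nat.
- by move=> *; exact: tf2_lin.
- by move=> *; exact: tf2_id.
- by move=> *; exact: tf2_comp.
- move=> i j l F G X Y f.
  rewrite (eqm_sval (res1_comp F G X) (tf1_comp F G (sval X))).
  by rewrite (eqm_sval (res1_comp F G Y) (tf1_comp F G (sval Y))) [LHS]tf1_compM.
- move=> i X Y f.
  rewrite (eqm_sval (res1_one X) (tf1_one (sval X))).
  by rewrite (eqm_sval (res1_one Y) (tf1_one (sval Y))) [LHS]tf1_oneM.
- move=> i j l F F' G G' a b X.
  rewrite (eqm_sval (res1_comp F G X) (tf1_comp F G (sval X))).
  rewrite (eqm_sval (res1_comp F' G' X) (tf1_comp F' G' (sval X))).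
  exact: tf2_hcomp.
Defined.

End Restriction.
End TwoFunctors.

Section Principal.
Variables (k : fieldType) (C : twocat k) (i : C).

Definition lcomp (j l : C) (F : C j l) : functor (C i j) (C i l).
Proof.
exists (fun G => F \o1 G) (fun G H b => idm F \o2 b).
- by move=> *; exact: hcomp2_linr.
- by move=> *; exact: hcomp2_id.
- by move=> G H K b a; rewrite -interchange mcomp1m.
Defined.

Fact lcomp_nat (j l : C) (F F' : C j l) (a : hom F F') :
  @natural k _ _ (lcomp F) (lcomp F') (fun G => a \o2 idm G).
Proof. by move=> G H b /=; rewrite -!interchange !mcomp1m !mcompm1. Qed.

Lemma aobj_eq (A : lincat k) (X Y : abar A)
    (e1 : asrc X = asrc Y) (e2 : atgt X = atgt Y) :
  eqm e2 \c amor X = amor Y \c eqm e1 -> X = Y.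
Proof.
case: X Y e1 e2 => [s t m] [s' t' m'] /= e1 e2; case: _ / e1 m' => m'.
by case: _ / e2 m' => m' /=; rewrite mcomp1m mcompm1 => ->.
Qed.

Lemma asquare_eqm (A : lincat k) (X Y : abar A) (e : X = Y) :
  asquare (eqm (congr1 (@asrc k A) e), eqm (congr1 (@atgt k A) e)).
Proof. by case: _ / e; rewrite /asquare /= mcomp1m mcompm1. Qed.

Lemma eqm_acls (A : lincat k) (X Y : abar A) (e : X = Y) :
  eqm e = acls (ASq (asquare_eqm e)).
Proof. by case: _ / e; apply: acls_ext. Qed.

Definition pri1 (j l : C) (F : C j l) : functor (abar (C i j)) (abar (C i l)) :=
  afun (lcomp F).

Definition pri2 (j l : C) (F G : C j l) (a : hom F G) :=
  anat (@lcomp_nat j l F G a).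

Lemma eqm_esym (A : lincat k) (x y x' y' : A) (e : x = x') (e' : y = y')
    (u : hom x y) (v : hom x' y') :
  eqm e' \c u = v \c eqm e -> eqm (esym e') \c v = u \c eqm (esym e).
Proof.
by case: _ / e v; case: _ / e' => v /=; rewrite !mcomp1m !mcompm1 => ->.
Qed.

Fact lcomp_comp (j l m : C) (F : C l m) (G : C j l) (H K : C i j) (a : hom H K) :
  eqm (esym (comp1A F G K)) \c (idm (F \o1 G) \o2 a)
  = (idm F \o2 (idm G \o2 a)) \c eqm (esym (comp1A F G H)).
Proof.
by apply: eqm_esym; have := hcomp2A (idm F) (idm G) a; rewrite hcomp2_id.
Qed.

Fact pri1_comp (j l m : C) (F : C l m) (G : C j l) (X : abar (C i j)) :
  pri1 (F \o1 G) X = pri1 F (pri1 G X).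
Proof.
apply: (@aobj_eq _ (pri1 (F \o1 G) X) (pri1 F (pri1 G X))
          (esym (comp1A F G (asrc X))) (esym (comp1A F G (atgt X)))).
exact: lcomp_comp.
Qed.

Fact pri1_one (j : C) (X : abar (C i j)) : pri1 (one1 j) X = X.
Proof.
apply: (@aobj_eq _ (pri1 (one1 j) X) X (comp1_1l _) (comp1_1l _)).
exact: hcomp2_1l.
Qed.

Fact eqm_irr (A : lincat k) (x y : A) (e e' : x = y) : eqm e = eqm e'.
Proof. by rewrite (Prop_irrelevance e e'). Qed.

Definition principal : twofunctor C.
Proof.
apply: (@TwoFunctor k C (fun j => abar (C i j)) pri1 pri2
          _ _ _ _ pri1_comp _ pri1_one).
- by move=> j l F G a; exact: anat_natural.
- move=> j l F G c a b X; rewrite -[RHS]lcls_linear.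
  apply: (@acls_ext _ _ (pri1 F X) (pri1 G X)); exact: hcomp2_linl.
- move=> j l F X.
  apply: (@acls_ext _ _ (pri1 F X) (pri1 F X)); exact: hcomp2_id.
- move=> j l F G H b a X; rewrite [RHS]acompE.
  apply: (@acls_ext _ _ (pri1 F X) (pri1 H X));
    by rewrite /= -interchange mcomp1m.
- move=> j l m F G X Y f; have [p ->] := acls_surj f.
  rewrite !eqm_acls /= !afmapE [LHS]acompE [RHS]acompE.
  apply: (@acls_ext _ _ (pri1 (F \o1 G) X) (pri1 F (pri1 G Y))) => /=;
    rewrite !(eqm_irr _ (esym (comp1A _ _ _))); exact: lcomp_comp.
- move=> j X Y f; have [p ->] := acls_surj f.
  rewrite !eqm_acls /= !afmapE [LHS]acompE [RHS]acompE.
  apply: (@acls_ext _ _ (pri1 (one1 j) X) Y) => /=;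
    rewrite !(eqm_irr _ (comp1_1l _)); exact: hcomp2_1l.
- move=> j l m F F' G G' a b X.
  rewrite !eqm_acls /= [in RHS]afmapE [LHS]acompE.
  rewrite [acomp (pri2 _ _) _]acompE [RHS]acompE.
  apply: (@acls_ext _ _ (pri1 (F \o1 G) X) (pri1 F' (pri1 G' X))) => /=;
    rewrite !(eqm_irr _ (esym (comp1A _ _ _))) -interchange mcomp1m mcompm1;
    exact/eqm_esym/hcomp2A.
Defined.
End Principal.

Section Cells.
Variables (k : fieldType) (C : twocat k).

(* A complete set of pairwise non-isomorphic indecomposable 1-morphisms, as  *)
(* an indexed family; the index types are finite by finitarity.              *)
Record indecs := Indecs {
  idx : C -> C -> finType;
  rep :> forall i j, idx i j -> C i j;
  rep_indec : forall i j (a : idx i j), indecomposable (rep a);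
  rep_inj : forall i j (a b : idx i j), isomorphic (rep a) (rep b) -> a = b;
  rep_surj : forall i j (F : C i j), indecomposable F ->
    exists a : idx i j, isomorphic F (rep a) }.

Variable S : indecs.

Record indec1 := Indec1 { i_src : C; i_tgt : C; i_idx : idx S i_src i_tgt }.

Inductive le_right : indec1 -> indec1 -> Prop :=
  LeRight i j l (a : idx S i j) (b : idx S i l) (H : C j l) :
    summand (S i l b) (H \o1 S i j a) -> le_right (Indec1 a) (Indec1 b).

Definition right_cell (R : set indec1) :=
  exists x, R = [set y | le_right x y /\ le_right y x]%classic.

Variables (R : set indec1) (i : C).

Definition cell_part (j : C) : finType := {a : idx S i j | `[< R (Indec1 a) >]}.

Local Notation P := (principal i).

Definition cell_act (X : P i) (j : C) (a : cell_part j) : P j :=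
  tf1 P (S i j (sval a)) X.

(* [u : K -> P_1] is the submodule K_R, with quotient [Y = P_1 / K_R]; [g] is *)
(* the index of G_R, and [L] the simple object attached to it.               *)
Definition is_G (g : idx S i i) :=
  exists (K Y L : P i) (u : hom K (Proj (one1 i) : P i))
    (q : hom (Proj (one1 i) : P i) Y),
  [/\ mono u /\ is_cokernel u q,
      forall X : P i, simple X -> subquotient X Y ->
        forall j (a : cell_part j), is_zero (cell_act X a),
      is_simple_head (S i i g) L,
      has_simple_top K L
    & forall j (a : cell_part j), ~ is_zero (cell_act L a)].

Definition has_resolution (j : C) (Q M : P j) :=
  exists (X1 X0 : P j) (d : hom X1 X0) (p : hom X0 M),
    [/\ in_add Q X1, in_add Q X0, exact_at d p & epi p].

End Cells.

(* Main.v *)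
From HB Require Import structures.
From mathcomp Require Import all_boot all_algebra.
From mathcomp Require Import boolp classical_sets.
Require Import Defs.

(* Let K_R ->> L be as in the definition of G_R. Every 1-morphism F acts by  *)
(* a functor with both adjoints given by F^*, hence exactly. Let D be        *)
(* indecomposable and >=_R some element of R. Then D kills P_1/K_R, so       *)
(* D K_R = P_D, and D L is a quotient of P_D.                                *)
(* - If D L <> 0, then by adjunction G_R is a summand of D^* D, while        *)
(*   lifting P_F ->> F L through P_{F G_R} ->> F L (F in R) shows that F is  *)
(*   a summand of F G_R; so G_R and D lie in R. Hence F Q_j is in add(Q_l),  *)
(*   and the objects presented by add(Q_j) are stable under the action.      *)
(* - Any P_D -> L vanishes unless D = G_R, in which case it kills the kernel *)
(*   of P_D ->> D L. Moving F' across by adjunction, every morphism          *)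
(*   P_F -> F' L with F, F' in R factors through P_F ->> F L. So Q_j behaves *)
(*   like a projective object on presentations by add(Q_j), and Hom(Q_j, -)  *)
(*   is an equivalence onto the modules over End(Q_j)^op.                    *)
Set Implicit Arguments.
Unset Strict Implicit.
Unset Printing Implicit Defensive.

Import GRing.Theory.
Local Open Scope ring_scope.
Local Open Scope lincat_scope.

Arguments hom : simpl never.
Arguments idm : simpl never.
Arguments mcomp : simpl never.
Arguments principal : simpl never.

(** * Finite-dimensional spaces *)

(** The argument has three pillars. Each 1-morphism acts on [principal i] as a left and as a right
    adjoint ([act_left_adj], [act_right_adj]), so it preserves cokernels and monomorphisms. As two
    step resolutions are cokernel diagrams ([resolution_cokernel]), stability only asks that the
    action send $\mathrm{add}(Q_j)$ into $\mathrm{add}(Q_l)$. This holds by [act_above_add], because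
    an indecomposable above the cell either kills [L] or lies in the cell ([above_cell_or_zero]).

    For [D] above the cell, $DK\cong P_D$ is projective ([above_K]), and every morphism $F_aK\to
    F_bL$ with $F_a,F_b$ in the cell factors through $F_aL$ ([factor_cell]). Hence
    $\mathrm{Hom}(Q_j,-)$ is exact on presentations by $\mathrm{add}(Q_j)$ ([Q_lifting]).

    For any object with this lifting property, $\mathrm{Hom}(Q,-)$ identifies the objects presented
    by $\mathrm{add}(Q)$ with the finite-dimensional modules over [end_alg]
    ([presentable_module_category]).

    The homological algebra of the abelianisation is done with morphisms from the projectives
    [Proj F] as generalised elements, and direct sum decompositions are replaced by the ideals
    [thru] of morphisms. *)

Section LinearMaps.
Variables (k : fieldType) (V W : lmodType k) (f : V -> W).
Hypothesis lf : linear f.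

Lemma lin0 : f 0 = 0.
Proof. by have := lf (-1) 0 0; rewrite scaler0 addr0 scaleN1r addNr. Qed.

Lemma linD : {morph f : x y / x + y}.
Proof. by move=> x y; have := lf 1 x y; rewrite !scale1r. Qed.

Lemma linZ c v : f (c *: v) = c *: f v.
Proof. by have := lf c v 0; rewrite !addr0 lin0 addr0. Qed.

Lemma lin_sum (I : finType) (F : I -> V) : f (\sum_i F i) = \sum_i f (F i).
Proof. exact: (big_morph f linD lin0). Qed.

Lemma lin_comb (I : finType) (c : I -> k) (s : I -> V) :
  f (\sum_i c i *: s i) = \sum_i c i *: f (s i).
Proof. by rewrite lin_sum; apply: eq_bigr => i _; rewrite linZ. Qed.

End LinearMaps.

Section FiniteDimension.
Variables (k : fieldType) (V : lmodType k).

(** The generators may lie outside [U]; [sub_spans] moves them inside. *)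
Definition spans n (s : 'I_n -> V) (U : V -> Prop) :=
  forall v, U v -> exists c : 'I_n -> k, v = \sum_i c i *: s i.

Lemma fin_dim_spans : fin_dim V ->
  exists n (s : 'I_n -> V), spans s (fun=> True).
Proof.
move=> [n [[f lf [g gK fK]]]]; exists n, (fun i => g (delta_mx 0 i)) => v _.
exists (fun i => f v 0 i); rewrite -[LHS]gK {1}[f v]row_sum_delta.
have lg : linear g by move=> c x y; apply: (can_inj gK); rewrite lf !fK.
by rewrite (lin_comb lg).
Qed.

(** Induction on the number of generators: intersect [U] with the span [W] of all but the first, and
    add one generator if some element of [U] involves [s ord0] with a nonzero coefficient. *)
Lemma sub_spans (U : submod V) n (s : 'I_n -> V) : spans s U ->
  exists m (t : 'I_m -> V), (forall i, U (t i)) /\ spans t U.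
Proof.
elim: n U s => [|n IH] U s sU.
  exists 0%N, s; split; [by case | exact: sU].
pose W v := exists c : 'I_n -> k, v = \sum_i c i *: s (lift ord0 i).
have W0 : W 0 by exists (fun=> 0); rewrite big1 // => i _; rewrite scale0r.
have WZD c u v : W u -> W v -> W (c *: u + v).
  move=> [a ->] [b ->]; exists (fun i => c * a i + b i).
  by rewrite scaler_sumr -big_split; apply: eq_bigr => i _; rewrite scalerDl scalerA.
have UW0 : U 0 /\ W 0 by split; [exact: submod0|].
have UWZD c u v : U u /\ W u -> U v /\ W v -> U (c *: u + v) /\ W (c *: u + v).
  by move=> [? ?] [? ?]; split; [exact: submodZD | exact: WZD].
have [m [t [tU tW]]] := IH (Submod UW0 UWZD) (fun i => s (lift ord0 i))
  (fun v (h : U v /\ W v) => proj2 h).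
case: (pselect (exists u a w, [/\ U u, W w, a != 0 & u = a *: s ord0 + w])).
  move=> [u [a [w [Uu Ww a0 ue]]]].
  exists m.+1, (fun i => if unlift ord0 i is Some j then t j else u).
  split=> [i|v Uv]; first by case: unliftP => // j _; case: (tU j).
  have [c] := sU v Uv; rewrite big_ord_recl.
  set w' := \sum_(_ < _) _ => vE; rewrite vE in Uv *.
  have Ww' : W w' by exists (fun i => c (lift ord0 i)).
  (* Subtracting this multiple of [u] cancels the [s ord0] component and leaves an element of both
     [U] and [W]. *)
  have [|d dE] := tW (c ord0 *: s ord0 + w' - (c ord0 / a) *: u).
    split; first by rewrite -scaleNr addrC; exact: submodZD.
    have -> : c ord0 *: s ord0 + w' - (c ord0 / a) *: u = (- (c ord0 / a)) *: w + w'.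
      rewrite ue scalerDr scalerA divfK // scaleNr opprD addrACA subrr.
      by rewrite add0r addrC.
    exact: WZD.
  exists (fun i => if unlift ord0 i is Some j then d j else c ord0 / a).
  rewrite big_ord_recl unlift_none.
  under eq_bigr => i _ do rewrite liftK.
  by rewrite /= -dE [RHS]addrC subrK.
move=> nex; exists m, t; split=> [i|v Uv]; first by case: (tU i).
apply: tW; split=> //; have [c] := sU v Uv; rewrite big_ord_recl => vE.
have Ww : W (\sum_(i < n) c (lift ord0 i) *: s (lift ord0 i)) by eexists.
case: (eqVneq (c ord0) 0) => [c0|c0]; first by rewrite vE c0 scale0r add0r.
by case: nex; exists v, (c ord0); eexists; split; first exact: Uv; first exact: Ww.
Qed.

Lemma spans_fin_dim n (s : 'I_n -> V) : spans s (fun=> True) -> fin_dim V.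
Proof.
move=> sV; pose P m := `[< exists t : 'I_m -> V, spans t (fun=> True) >].
have exP : exists m, P m by exists n; apply/asboolP; exists s.
case: (ex_minnP exP) => m /asboolP[t tV] minm.
have free (c : 'I_m -> k) : \sum_i c i *: t i = 0 -> forall i, c i = 0.
  move=> ct j; apply/eqP; apply: contraT => cj.
  case: m t tV minm c ct j cj => [|m] t tV minm c ct j cj; first by case: j cj.
  have: (m.+1 <= m)%N; last by rewrite ltnn.
  apply: minm; apply/asboolP; exists (t \o lift j) => v _.
  have [d ->] := tV v I.
  exists (fun i => d (lift j i) - d j / c j * c (lift j i)).
  have tj : t j = - (c j)^-1 *: \sum_(i < m) c (lift j i) *: t (lift j i).
    move: ct; rewrite (bigD1_ord j) //= => /eqP; rewrite addr_eq0 => /eqP e.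
    by rewrite scaleNr -scalerN -e scalerA mulVf // scale1r.
  rewrite (bigD1_ord j) //= {1}tj scalerA scaler_sumr -big_split.
  apply: eq_bigr => i _; rewrite /= scalerA -scalerDl; congr (_ *: _).
  by rewrite addrC mulrN !mulNr.
pose f v := \row_i (sval (cid (tV v I))) i.
have fE v : v = \sum_i f v 0 i *: t i.
  rewrite {1}(svalP (cid (tV v I))).
  by apply: eq_bigr => i _; rewrite mxE.
have f_uniq v (r : 'rV_m) : v = \sum_i r 0 i *: t i -> f v = r.
  move=> e; apply/rowP => i; apply/eqP; rewrite -subr_eq0; apply/eqP.
  apply: (free (fun i => f v 0 i - r 0 i)).
  under eq_bigr => j _ do rewrite scalerBl.
  by rewrite sumrB -fE -e subrr.
exists m; constructor; exists f.
  move=> c u v; apply: f_uniq; rewrite {1}(fE u) {1}(fE v) scaler_sumr -big_split.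
  by apply: eq_bigr => i _; rewrite !mxE scalerDl scalerA.
exists (fun r : 'rV_m => \sum_i r 0 i *: t i) => [v|r]; first by rewrite -fE.
exact: f_uniq.
Qed.

Definition independent m (s : 'I_m -> V) :=
  forall c : 'I_m -> k, \sum_i c i *: s i = 0 -> forall i, c i = 0.

Lemma independent_bound : fin_dim V ->
  exists n, forall m (s : 'I_m -> V), independent s -> (m <= n)%N.
Proof.
move=> [n [[f lf [g gK fK]]]]; exists n => m s ind.
pose M := \matrix_(i < m) f (s i).
have: row_free M.
  rewrite -kermx_eq0; apply/rowV0P => v /sub_kermxP vM.
  have e : \sum_i v 0 i *: s i = 0.
    apply: (can_inj gK); rewrite (lin_comb lf) (lin0 lf) -[RHS]vM mulmx_sum_row.
    by apply: eq_bigr => i _; rewrite rowK.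
  by apply/rowP => i; rewrite mxE (ind _ e).
by rewrite /row_free => /eqP <-; exact: rank_leq_col.
Qed.

End FiniteDimension.

Lemma fin_dim_surj (k : fieldType) (V W : lmodType k) (f : V -> W) :
  linear f -> (forall w, exists v, f v = w) -> fin_dim V -> fin_dim W.
Proof.
move=> lf fs /fin_dim_spans[n [s sV]].
apply: (@spans_fin_dim _ _ n (f \o s)) => w _; have [v <-] := fs w.
have [c ->] := sV v I; by exists c; rewrite (lin_comb lf).
Qed.

Lemma fin_dim_inj (k : fieldType) (V W : lmodType k) (f : V -> W) :
  linear f -> injective f -> fin_dim W -> fin_dim V.
Proof.
move=> lf fi /fin_dim_spans[n [s sW]].
have U0 : exists v, f v = 0 by exists 0; exact: (lin0 lf).
have UZD c u v : (exists x, f x = u) -> (exists x, f x = v) ->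
    exists x, f x = c *: u + v.
  by move=> [x <-] [y <-]; exists (c *: x + y); rewrite lf.
have [m [t [tU tS]]] := @sub_spans _ _ (Submod U0 UZD) n s (fun v _ => sW v I).
pose t' i := sval (cid (tU i)).
have t'E i : f (t' i) = t i by exact: (svalP (cid (tU i))).
apply: (@spans_fin_dim _ _ m t') => v _.
have [|c cE] := tS (f v); first by exists v.
exists c; apply: fi; rewrite cE (lin_comb lf).
by apply: eq_bigr => i _; rewrite t'E.
Qed.

(** * Linear categories *)

Section LinearCategory.
Variables (k : fieldType) (A : lincat k).
Implicit Types x y z : A.

Lemma comp0m x y z (f : hom x y) : (0 : hom y z) \c f = 0.
Proof. exact: (lin0 (@mcomp_linl _ _ _ _ z f)). Qed.
Lemma compm0 x y z (g : hom y z) : g \c (0 : hom x y) = 0.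
Proof. exact: (lin0 (@mcomp_linr _ _ x _ _ g)). Qed.
Lemma compDl x y z (g h : hom y z) (f : hom x y) : (g + h) \c f = g \c f + h \c f.
Proof. exact: (linD (@mcomp_linl _ _ _ _ z f)). Qed.
Lemma compDr x y z (g : hom y z) (f h : hom x y) : g \c (f + h) = g \c f + g \c h.
Proof. exact: (linD (@mcomp_linr _ _ x _ _ g)). Qed.
Lemma compZl x y z c (g : hom y z) (f : hom x y) : (c *: g) \c f = c *: (g \c f).
Proof. exact: (linZ (@mcomp_linl _ _ _ _ z f)). Qed.
Lemma compZr x y z c (g : hom y z) (f : hom x y) : g \c (c *: f) = c *: (g \c f).
Proof. exact: (linZ (@mcomp_linr _ _ x _ _ g)). Qed.
Lemma comp_suml (I : finType) x y z (g : I -> hom y z) (f : hom x y) :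
  (\sum_i g i) \c f = \sum_i g i \c f.
Proof. exact: (lin_sum (@mcomp_linl _ _ _ _ z f)). Qed.
Lemma comp_sumr (I : finType) x y z (g : hom y z) (f : I -> hom x y) :
  g \c (\sum_i f i) = \sum_i g \c f i.
Proof. exact: (lin_sum (@mcomp_linr _ _ x _ _ g)). Qed.

Lemma zero_from x y (f : hom x y) : is_zero x -> f = 0.
Proof. by move=> z; rewrite -[f]mcompm1 z compm0. Qed.
Lemma zero_to x y (f : hom x y) : is_zero y -> f = 0.
Proof. by move=> z; rewrite -[f]mcomp1m z comp0m. Qed.

Lemma epi0 x y (f : hom x y) : epi f -> f = 0 -> is_zero y.
Proof. by move=> ef f0; apply: ef; rewrite f0 !compm0. Qed.

Lemma mono0 x y z (f : hom y z) (u : hom x y) : mono f -> f \c u = 0 -> u = 0.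
Proof. by move=> mf fu; apply: mf; rewrite fu compm0. Qed.

Lemma epi_comp x y z (g : hom y z) (f : hom x y) : epi g -> epi f -> epi (g \c f).
Proof. by move=> eg ef t u v; rewrite !mcompA => /ef/eg. Qed.

Lemma cokernel_epi x y z (f : hom x y) (p : hom y z) : is_cokernel f p -> epi p.
Proof.
move=> [pf cok] t u v uv; have [|w [_ wu]] := cok t (v \c p).
  by rewrite -mcompA pf compm0.
by rewrite -(wu u) // -(wu v).
Qed.

Lemma iso_epi x y (f : hom x y) : is_iso f -> epi f.
Proof.
by move=> [g [_ fg]] z u v e; rewrite -[u]mcompm1 -fg mcompA e -mcompA fg mcompm1.
Qed.

Lemma iso_comp x y z (g : hom y z) (f : hom x y) :
  is_iso g -> is_iso f -> is_iso (g \c f).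
Proof.
move=> [g' [g'g gg']] [f' [f'f ff']]; exists (f' \c g').
by split; rewrite -mcompA; [rewrite (mcompA g') g'g | rewrite (mcompA f) ff'];
  rewrite mcomp1m.
Qed.

Lemma iso_id x : is_iso (idm x).
Proof. by exists (idm x); rewrite mcomp1m. Qed.

Lemma isomorphic_sym x y : isomorphic x y -> isomorphic y x.
Proof. by move=> [f [g [gf fg]]]; exists g, f. Qed.

Lemma isomorphic_trans x y z : isomorphic x y -> isomorphic y z -> isomorphic x z.
Proof. by move=> [f hf] [g hg]; exists (g \c f); exact: iso_comp. Qed.

(** A summand without its complement. The two notions agree once idempotents split
    ([retract_summand]), and this one composes and passes through functors at once. *)
Definition retract x y := exists (i : hom x y) (p : hom y x), p \c i = idm x.

Lemma retract_trans x y z : retract x y -> retract y z -> retract x z.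
Proof.
move=> [i [p pi]] [j [q qj]]; exists (j \c i), (p \c q).
by rewrite -mcompA (mcompA q) qj mcomp1m.
Qed.

Lemma isomorphic_retract x y : isomorphic x y -> retract x y.
Proof. by move=> [f [g [gf _]]]; exists f, g. Qed.

Lemma retract_zero x y : retract x y -> is_zero y -> is_zero x.
Proof. by move=> [i [p pi]] y0; rewrite /is_zero -pi (zero_to i y0) compm0. Qed.

Lemma dsum2P x y z : is_dsum2 x y z <->
  exists (i : hom x z) (p : hom z x) (j : hom y z) (q : hom z y),
  [/\ p \c i = idm x, q \c j = idm y, q \c i = 0, p \c j = 0
    & i \c p + j \c q = idm z].
Proof.
split=> [[inj [prj [h1 h2 h3]]]|[i [p [j [q [pi qj qi pj e]]]]]].
  exists (inj true), (prj true), (inj false), (prj false); split.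
  - exact: (h1 true).
  - exact: (h1 false).
  - exact: (h2 true false).
  - exact: (h2 false true).
  - by rewrite -h3 big_bool.
exists (fun b => if b return hom (if b then x else y) z then i else j).
exists (fun b => if b return hom z (if b then x else y) then p else q).
by split=> [[]|[] []|] //; rewrite big_bool.
Qed.

Lemma dsum_retract (I : finType) (x : I -> A) y a : is_dsum x y -> retract (x a) y.
Proof. by move=> [inj [prj [h _ _]]]; exists (inj a), (prj a). Qed.

Lemma summand_retract x y : summand x y -> retract x y.
Proof. by move=> [x' /dsum2P[i [p [_ [_ [pi _ _ _ _]]]]]]; exists i, p. Qed.

Definition split_idempotents := forall x (e : hom x x), e \c e = e ->
  exists y (p : hom x y) (i : hom y x), p \c i = idm y /\ i \c p = e.

Lemma idempotent_dsum2 (sp : split_idempotents) x y (i : hom y x) (p : hom x y) :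
  p \c i = idm y -> exists z (j : hom z x) (q : hom x z),
  [/\ q \c j = idm z, q \c i = 0, p \c j = 0 & i \c p + j \c q = idm x].
Proof.
move=> pi; pose e := idm x - i \c p.
have ei : e \c i = 0 by rewrite mcompBl mcomp1m -mcompA pi mcompm1 subrr.
have pe : p \c e = 0 by rewrite mcompBr mcompm1 mcompA pi mcomp1m subrr.
have [|z [q [j [qj jq]]]] := sp x e.
  by rewrite {2}/e mcompBr mcompm1 mcompA ei comp0m subr0.
exists z, j, q; split=> //.
- by rewrite -[q]mcomp1m -qj -!mcompA (mcompA j) jq ei compm0.
- by rewrite -[j]mcompm1 -qj (mcompA j) jq mcompA pe comp0m.
- by rewrite jq addrC subrK.
Qed.

Lemma retract_summand (sp : split_idempotents) x y : retract x y -> summand x y.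
Proof.
move=> [i [p pi]]; have [z [j [q [qj qi pj e]]]] := idempotent_dsum2 sp pi.
by exists z; apply/dsum2P; exists i, p, j, q.
Qed.

(* The ideal of morphisms factoring through finite direct sums of objects    *)
(* satisfying [T], without assuming that these direct sums exist.            *)
Inductive thru (T : A -> Prop) : forall x y, hom x y -> Prop :=
| thru0 x y : thru T (0 : hom x y)
| thruD x y (f g : hom x y) : thru T f -> thru T g -> thru T (f + g)
| thru_comp x z y (f : hom z y) (g : hom x z) : T z -> thru T (f \c g).

Lemma thru_l T x y z (g : hom y z) (f : hom x y) : thru T f -> thru T (g \c f).
Proof.
move=> tf; elim: tf z g => {x y f} [x y|x y f f' _ IH _ IH'|x t y f g Tt] z h.
- by rewrite compm0; constructor.
- by rewrite compDr; constructor; auto.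
- by rewrite mcompA; constructor.
Qed.

Lemma thru_r T x y z (g : hom y z) (f : hom x y) : thru T g -> thru T (g \c f).
Proof.
move=> tg; elim: tg x f => {y z g} [y z|y z g g' _ IH _ IH'|y t z g g' Tt] x h.
- by rewrite comp0m; constructor.
- by rewrite compDl; constructor; auto.
- by rewrite -mcompA; constructor.
Qed.

Lemma thru_obj (T : A -> Prop) x : T x -> thru T (idm x).
Proof. by move=> Tx; rewrite -[idm x]mcomp1m; constructor. Qed.

Lemma thru_sum (I : finType) T x y (f : I -> hom x y) :
  (forall a, thru T (f a)) -> thru T (\sum_a f a).
Proof. by move=> tf; apply: big_ind => // *; constructor. Qed.

Lemma thru_trans (T T' : A -> Prop) x y (f : hom x y) :
  (forall z, T z -> thru T' (idm z)) -> thru T f -> thru T' f.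
Proof.
move=> TT'; elim=> {x y f} [x y|x y f g _ tf _ tg|x z y f g Tz].
- exact: thru0.
- exact: thruD.
- by rewrite -[f]mcompm1; apply: thru_r; apply: thru_l; exact: TT'.
Qed.

Lemma thru_retract T x y : retract x y -> thru T (idm y) -> thru T (idm x).
Proof. by move=> [i [p <-]] ty; rewrite -[i]mcomp1m; apply/thru_l/thru_r. Qed.

Lemma thru_dsum (I : finType) T (x : I -> A) y :
  is_dsum x y -> (forall a, thru T (idm (x a))) -> thru T (idm y).
Proof.
move=> [inj [prj [_ _ <-]]] tx; apply: thru_sum => a.
by rewrite -[inj a]mcompm1; apply/thru_r/thru_l.
Qed.

Lemma thru_eqP q x y (f : hom x y) : thru (fun z => z = q) f ->
  exists n (g : 'I_n -> hom q y) (h : 'I_n -> hom x q), f = \sum_i g i \c h i.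
Proof.
elim=> {x y f} [x y|x y f f' _ [n [g [h ->]]] _ [n' [g' [h' ->]]]|x z y f g zq].
- by exists 0%N, (fun=> 0), (fun=> 0); rewrite big_ord0.
- exists (n + n')%N, (fun i => match split i with inl a => g a | inr b => g' b end),
    (fun i => match split i with inl a => h a | inr b => h' b end).
  rewrite big_split_ord /=; congr (_ + _); apply: eq_bigr => i _.
    by rewrite (unsplitK (inl i)).
  by rewrite (unsplitK (inr i)).
- by case: _ / (esym zq) f g => f g; exists 1%N, (fun=> f), (fun=> g); rewrite big_ord1.
Qed.

Lemma thru_sep (T : A -> Prop) x y z (u v : hom y z) (f : hom x y) : thru T f ->
  (forall t (w : hom t y), T t -> u \c w = v \c w) -> u \c f = v \c f.
Proof.
move=> tf uv; elim: tf u v uv => {x y f} [x y|x y f g _ IH _ IH'|x t y f g Tt] u v uv.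
- by rewrite !compm0.
- by rewrite !compDr (IH _ _ uv) (IH' _ _ uv).
- by rewrite !mcompA (uv _ f).
Qed.

End LinearCategory.

Lemma thru_fmap (k : fieldType) (A B : lincat k) (F : functor A B)
    (T : A -> Prop) (T' : B -> Prop) x y (f : hom x y) :
  (forall z, T z -> thru T' (idm (F z))) -> thru T f -> thru T' (fmap F f).
Proof.
move=> TT'; elim=> {x y f} [x y|x y f g _ tf _ tg|x z y f g Tz].
- by rewrite (lin0 (@fmap_lin _ _ _ F x y)); exact: thru0.
- by rewrite (linD (@fmap_lin _ _ _ F x y)); exact: thruD.
- rewrite fmapM -[fmap F f]mcompm1; apply: thru_r; apply: thru_l; exact: TT'.
Qed.

(** * Fitting and Krull-Schmidt *)

Section KrullSchmidt.
Variables (k : fieldType) (A : lincat k).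
Hypothesis sp : split_idempotents A.
Hypothesis fd : forall x y : A, fin_dim (hom x y).
Implicit Types x y z : A.

Lemma indecomposable_idempotent x (e : hom x x) :
  indecomposable x -> e \c e = e -> e = 0 \/ e = idm x.
Proof.
move=> [x0 dx] ee; have [y [p [i [pi ip]]]] := sp ee.
have [z [j [q [qj qi pj ijx]]]] := idempotent_dsum2 sp pi.
have [|y0|z0] := dx y z; first by apply/dsum2P; exists i, p, j, q.
  by left; rewrite -ip (zero_to p y0) compm0.
by right; rewrite -ip -ijx (zero_to q z0) compm0 addr0.
Qed.

Section Fitting.
Variables (x : A) (f : hom x x).

Definition hpow n : hom x x := iter n (mcomp f) (idm x).

Lemma hpowD m n : hpow (m + n) = hpow m \c hpow n.
Proof. by elim: m => [|m IH]; rewrite ?mcomp1m // addSn /= IH mcompA. Qed.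

Lemma hpow_commute (q : hom x x) n : q \c f = f \c q -> q \c hpow n = hpow n \c q.
Proof.
move=> qf; elim: n => [|n IH] /=; first by rewrite mcompm1 mcomp1m.
by rewrite mcompA qf -!mcompA IH.
Qed.

(** The powers of [f] are linearly dependent. In a relation whose lowest nonzero coefficient is that
    of [hpow m], one can solve for [hpow m] as [hpow m.+1] times a polynomial in [f]. *)
Lemma hpow_stable : exists m q, q \c f = f \c q /\ hpow m.+1 = hpow m.+2 \c q.
Proof.
have [N bN] := independent_bound (fd x x).
have: ~ independent (fun i : 'I_N.+1 => hpow i) by move=> /bN; rewrite ltnn.
move=> /existsNP[c /not_implyP[c0 /existsNP[j /eqP cj]]].
pose P m := (m <= N)%N && (c (inord m) != 0).
have exP : exists m, P m.
  by exists j; rewrite /P -ltnS ltn_ord inord_val.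
case: (ex_minnP exP) => m /andP[mN cm] minm.
(* The part of the relation above degree [m], divided by [hpow m.+1]. *)
pose r : hom x x := \sum_(i < N.+1 | (m < i)%N) c i *: hpow (i - m.+1).
have rf : r \c f = f \c r.
  rewrite /r; elim/big_ind: _ => [|g h gf hf|i _].
  - by rewrite comp0m compm0.
  - by rewrite compDl compDr gf hf.
  - by rewrite compZl compZr (hpow_commute _ (erefl : f \c f = f \c f)).
have mr : c (inord m) *: hpow m = - (hpow m.+1 \c r).
  apply/eqP; rewrite -addr_eq0 -c0 (bigID (fun i : 'I_N.+1 => (m < i)%N)) /= addrC.
  apply/eqP; congr (_ + _); last first.
    rewrite -[f \c hpow m]/(hpow m.+1) /r.
    rewrite (big_morph (fun g => hpow m.+1 \c g) (compDr _) (compm0 _ _)).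
    by apply: eq_bigr => i mi; rewrite compZr -hpowD subnKC.
  rewrite [RHS](bigD1 (inord m)) /=; last by rewrite inordK // ltnn.
  rewrite inordK // big1 ?addr0 // => i /andP[im ine].
  have im' : (i < m)%N.
    rewrite ltn_neqAle leqNgt im andbT; apply: contra ine => /eqP e.
    by apply/eqP/val_inj; rewrite /= inordK.
  case: (eqVneq (c i) 0) => [->|ci]; first by rewrite scale0r.
  have := minm i; rewrite /P -ltnS ltn_ord inord_val ci => /(_ isT).
  by rewrite leqNgt im'.
exists m, (- (c (inord m))^-1 *: r); split.
  by rewrite compZl compZr rf.
have me : hpow m = - (c (inord m))^-1 *: (hpow m.+1 \c r).
  by rewrite scaleNr -scalerN -mr scalerA mulVf // scale1r.
by rewrite -[LHS]/(f \c hpow m) me !compZr mcompA.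
Qed.

(** The idempotent [e] projects onto the stable image of [f] and satisfies
    [hpow m.+1 \c e = hpow m.+1]. By indecomposability it is 0, and [f] is nilpotent, or it is 1,
    and [f] is invertible. *)
Lemma fitting : indecomposable x -> is_iso f \/ exists n, hpow n = 0.
Proof.
move=> indx; have [m [q [qf fq]]] := hpow_stable.
pose qn n : hom x x := iter n (mcomp q) (idm x).
have qnf n : qn n \c f = f \c qn n.
  elim: n => [|n IH]; first by rewrite /qn /= mcompm1 mcomp1m.
  by rewrite /qn /= -mcompA -/(qn n) IH !mcompA qf.
have st n : hpow m.+1 = hpow (m.+1 + n) \c qn n.
  elim: n => [|n IH]; first by rewrite addn0 mcompm1.
  by rewrite {1}IH addnC hpowD fq mcompA -hpowD -mcompA addnC addSnnS.
pose e := hpow m.+1 \c qn m.+1.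
have pe : hpow m.+1 \c e = hpow m.+1 by rewrite /e mcompA -hpowD -st.
have ee : e \c e = e.
  by rewrite {1}/e -(hpow_commute m.+1 (qnf m.+1)) -mcompA pe /e hpow_commute.
have [e0|e1] := indecomposable_idempotent indx ee.
  by right; exists m.+1; rewrite -pe e0 compm0.
left; exists (hpow m \c qn m.+1); split.
  rewrite -mcompA qnf mcompA -e1 /e; congr (_ \c _).
  by rewrite -(hpow_commute m (erefl : f \c f = f \c f)).
by rewrite mcompA -e1.
Qed.

Lemma hpow_fix y (r : hom x y) n : r \c f = r -> r \c hpow n = r.
Proof. by move=> rf; elim: n => [|n IH] /=; rewrite ?mcompm1 // mcompA rf. Qed.

(** Every power of [f] fixes [r], so [f] is not nilpotent. This is how a pair of opposite lifts
    between projectives later becomes a retraction. *)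
Lemma fix_iso y (r : hom x y) : indecomposable x -> r <> 0 -> r \c f = r -> is_iso f.
Proof.
move=> xi r0 rf; have [//|[n fn]] := fitting xi; case: r0.
by rewrite -(hpow_fix n rf) fn compm0.
Qed.

Lemma nilpotent_iso n : hpow n = 0 -> is_iso (idm x - f).
Proof.
move=> fn; exists (\sum_(i < n) hpow i).
have e m : (idm x - f) \c \sum_(i < m) hpow i = idm x - hpow m.
  elim: m => [|m IH]; first by rewrite big_ord0 compm0 subrr.
  by rewrite big_ord_recr /= compDr IH mcompBl mcomp1m addrA subrK.
have e' m : (\sum_(i < m) hpow i) \c (idm x - f) = idm x - hpow m.
  elim: m => [|m IH]; first by rewrite big_ord0 comp0m subrr.
  rewrite big_ord_recr /= compDl IH mcompBr mcompm1 addrA subrK.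
  by rewrite -(hpow_commute m (erefl : f \c f = f \c f)).
by rewrite e e' fn subr0.
Qed.

End Fitting.

(** With [h] the inverse of the sum, [h \c f] and [h \c g] add up to 1; if the first is nilpotent,
    the second is inverted by a geometric series. *)
Lemma local_add x (f g : hom x x) :
  indecomposable x -> is_iso (f + g) -> is_iso f \/ is_iso g.
Proof.
move=> xi [h [hfg fgh]].
have [hfi|[n hfn]] := fitting (h \c f) xi.
  left; have -> : f = (f + g) \c (h \c f) by rewrite mcompA fgh mcomp1m.
  by apply: iso_comp => //; exists h.
right; have -> : g = (f + g) \c (idm x - h \c f).
  by rewrite mcompBr mcompm1 mcompA fgh mcomp1m addrC addKr.
by apply: iso_comp (nilpotent_iso hfn); exists h.
Qed.

(** Endomorphisms of [x] extended by zero stay independent when the projector onto [y] is added.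
    Splitting off a nonzero summand thus lowers the bound on independent families, the induction
    parameter of [thru_indecomposable]. *)
Lemma independent_dsum x y z : is_dsum2 x y z -> ~ is_zero y ->
  forall m (s : 'I_m -> hom x x), independent s ->
  exists t : 'I_m.+1 -> hom z z, independent t.
Proof.
move=> /dsum2P[i [p [j [q [pi qj qi pj e]]]]] y0 m s ind.
exists (fun a => if unlift ord0 a is Some b then i \c s b \c p else j \c q) => c.
rewrite big_ord_recl unlift_none; under eq_bigr => a _ do rewrite liftK.
move=> c0.
have c00 : c ord0 = 0.
  apply/eqP/negP => /negP cn; apply: y0.
  have := congr1 (fun f => q \c f \c j) c0.
  rewrite /= comp0m compm0 compDl compDr compZl compZr -mcompA qj mcompm1 qj.
  rewrite comp_suml comp_sumr big1 ?addr0 => [|a _]; last first.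
    by rewrite compZl compZr mcompA (mcompA q) qi !comp0m scaler0.
  by move/eqP; rewrite scaler_eq0 (negPf cn) => /eqP.
move=> a; case: (unliftP ord0 a) => [b ->|-> //].
apply: (ind (fun b => c (lift ord0 b))).
have := congr1 (fun f => p \c f \c i) c0.
rewrite /= c00 scale0r add0r comp0m compm0 comp_suml comp_sumr => s0.
rewrite -[RHS]s0.
apply: eq_bigr => b' _; rewrite compZl compZr; congr (_ *: _).
by rewrite -!mcompA pi mcompm1 mcompA pi mcomp1m.
Qed.

Lemma dsum2_sym x y z : is_dsum2 x y z -> is_dsum2 y x z.
Proof.
move=> /dsum2P[i [p [j [q [pi qj qi pj e]]]]]; apply/dsum2P.
by exists j, q, i, p; split=> //; rewrite addrC.
Qed.

Lemma thru_indecomposable x :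
  thru (fun y => indecomposable y /\ retract y x) (idm x).
Proof.
have [N] := independent_bound (fd x x).
elim: N x => [|N IH] x bN.
  case: (pselect (is_zero x)) => [->|x0]; first exact: thru0.
  suff /bN : independent (fun _ : 'I_1 => idm x) by [].
  move=> c; rewrite big_ord1 => /eqP; rewrite scaler_eq0.
  by move=> /orP[/eqP c0 i|/eqP/x0//]; rewrite ord1.
case: (pselect (is_zero x)) => [->|x0]; first exact: thru0.
case: (pselect (indecomposable x)) => [xi|].
  by apply: thru_obj; split=> //; apply: isomorphic_retract; exists (idm x); exact: iso_id.
move=> /not_andP[//|/existsNP[y /existsNP[z /not_implyP[dyz /not_orP[y0 z0]]]]].
have key u v : is_dsum2 u v x -> ~ is_zero v ->
    thru (fun y => indecomposable y /\ retract y x) (idm u).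
  move=> duv v0; apply: thru_trans (IH u _) => [t [ti tu]|m s ind].
    apply: thru_obj; split=> //; apply: (retract_trans tu).
    by apply: (@dsum_retract _ _ _ (fun b : bool => if b then u else v) x true).
  by have [t /bN] := independent_dsum duv v0 ind.
apply: (thru_dsum dyz) => -[]; first exact: (key y z).
by apply: (key z y) => //; exact: dsum2_sym.
Qed.

End KrullSchmidt.

(** * The abelianisation *)

(** A linear subfunctor of $\mathrm{Hom}(-,X)$; annihilators and radicals are the instances used. *)
Definition right_ideal (k : fieldType) (B : lincat k) (X : B)
    (N : forall E, hom E X -> Prop) :=
  [/\ forall E, N E 0, forall E c u v, N E u -> N E v -> N E (c *: u + v)
    & forall E E' (u : hom E X) (g : hom E' E), N E u -> N E' (u \c g)].

Section Abelianisation.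
Variables (k : fieldType) (A : lincat k).
Hypothesis hA : finitary_cat A.
Local Notation B := (abar A).
Implicit Types (F : A) (X Y Z : B).

Let zA : exists z : A, is_zero z. Proof. by have [[? _ _] _ _] := hA. Qed.
Let sumA (x y : A) : exists z, is_dsum2 x y z. Proof. by have [[_ h _] _ _] := hA. Qed.
Let spA : split_idempotents A. Proof. by have [[_ _ h] _ _] := hA. Qed.
Let fdA (x y : A) : fin_dim (hom x y). Proof. by have [_ h _] := hA. Qed.

Lemma zero_objP F : is_zero (zero_obj F).
Proof. by rewrite /zero_obj; case: pselect => // h; case: cid. Qed.

Fact pcl_subproof F X (h : hom F (atgt X)) :
  @asquare k A (Proj F) X (0 : hom (zero_obj F) (asrc X), h).
Proof. by rewrite /asquare /= !compm0. Qed.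

(* By Yoneda, the morphism [Proj F -> X] induced by [h]. *)
Definition pcl F X (h : hom F (atgt X)) : hom (Proj F : B) X :=
  acls (ASq (pcl_subproof h)).

Lemma pcl_surj F X (f : hom (Proj F : B) X) : exists h, f = pcl h.
Proof.
have [p ->] := acls_surj f; exists (lval p).2; apply: acls_ext => //=.
exact: zero_from (zero_objP F).
Qed.

Lemma pcl_linear F X : linear (@pcl F X).
Proof.
move=> c u v; rewrite -[RHS]lcls_linear; apply: (@acls_ext _ _ (Proj F) X) => //=.
by rewrite scaler0 addr0.
Qed.

Lemma pcl0 F X : @pcl F X 0 = 0.
Proof. exact: (lin0 (@pcl_linear F X)). Qed.

Lemma pcl_eq0 F X (h : hom F (atgt X)) :
  pcl h = 0 <-> exists xi, amor X \c xi = h.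
Proof.
have E := acls_eq (ASq (pcl_subproof h)) (ASq (@pcl_subproof F X 0)).
rewrite /= subr0 in E; rewrite -pcl0; exact: E.
Qed.

Lemma acls_eq0 X Y (p : lsub (asquares X Y)) :
  (acls p : hom (X : B) Y) = 0 <-> exists xi, amor Y \c xi = (lval p).2.
Proof.
have E := acls_eq p 0; rewrite /= subr0 in E.
rewrite -[X in _ = X <-> _](lin0 (@lcls_linear _ _ (anulls X Y))); exact: E.
Qed.

Lemma comp_pcl X Y F (p : lsub (asquares X Y)) (h : hom F (atgt X)) :
  (acls p : hom (X : B) Y) \c pcl h = pcl ((lval p).2 \c h).
Proof.
by rewrite [LHS]acompE; apply: acls_ext => //=; rewrite compm0.
Qed.

Local Notation pmap g := (@pcl _ (Proj _) g).

Lemma pcl_comp X F G (h : hom G (atgt X)) (g : hom F G) :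
  pcl h \c pmap g = pcl (h \c g).
Proof. by rewrite [LHS]comp_pcl. Qed.

Lemma pcl_id F : pmap (idm F) = idm _.
Proof. by apply: acls_ext => //=; symmetry; apply: zero_from; exact: zero_objP. Qed.

Definition cov X : hom (Proj (atgt X) : B) X := pcl (idm (atgt X)).

Lemma pcl_cov F X (h : hom F (atgt X)) :
  pcl h = cov X \c pmap h.
Proof. by rewrite /cov pcl_comp mcomp1m. Qed.

(** Whether a morphism is null is decided by its second component alone, and precomposing with an
    identity there changes nothing. *)
Lemma tgt_epi X Y (p : lsub (asquares X Y)) (e : atgt X = atgt Y) :
  (lval p).2 = eqm e -> epi (acls p : hom (X : B) Y).
Proof.
move=> pe Z u v; have [r ->] := acls_surj u; have [s ->] := acls_surj v.
rewrite [LHS]acompE [RHS]acompE => /acls_eq[xi /=]; rewrite pe => xiE.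
apply/acls_eq; exists (xi \c eqm (esym e)).
rewrite mcompA xiE mcompBl -!mcompA.
have -> : eqm e \c eqm (esym e) = idm (atgt Y).
  by case: _ / e {xi pe xiE} => /=; rewrite mcomp1m.
by rewrite !mcompm1.
Qed.

Lemma cov_epi X : epi (cov X).
Proof. exact: (@tgt_epi (Proj (atgt X)) X _ erefl). Qed.

Lemma abar_fin_dim X Y : fin_dim (hom X Y).
Proof.
apply: (@fin_dim_inj _ _ (hom (Proj (atgt X) : B) Y) (fun f => f \c cov X)).
- exact: mcomp_linl.
- exact: cov_epi.
- apply: (fin_dim_surj (@pcl_linear (atgt X) Y)); last exact: fdA.
  by move=> f; have [h ->] := pcl_surj f; exists h.
Qed.

Lemma hom_ext X Y (u v : hom X Y) :
  (forall F (x : hom (Proj F : B) X), u \c x = v \c x) -> u = v.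
Proof. by move=> uv; apply: (@cov_epi X); exact: uv. Qed.

(** Exactness at [Y] tested on generalised elements; unlike [exact_at] it mentions no kernel
    object. *)
Definition elex X Y Z (f : hom X Y) (g : hom Y Z) :=
  g \c f = 0 /\ forall F (y : hom (Proj F : B) Y), g \c y = 0 -> exists x, y = f \c x.

Lemma presentation X :
  elex (pmap (amor X)) (cov X).
Proof.
split=> [|F y]; first by rewrite -pcl_cov; apply/pcl_eq0; exists (idm _); rewrite mcompm1.
have [h ->] := pcl_surj y; rewrite -pcl_cov => /pcl_eq0[xi <-].
by exists (pmap xi); rewrite pcl_comp.
Qed.

(** The cokernel of $X\to Y$ keeps the target of [Y] and enlarges its relations by the target of
    [X]: it is the diagram [m] from the sum of [asrc Y] and [atgt X] to [atgt Y]. *)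
Lemma cokernel_exists X Y (f : hom X Y) :
  exists Z (c : hom Y Z), is_cokernel f c /\ elex f c.
Proof.
have [p ->] := acls_surj f.
have [S /dsum2P[i1 [p1 [i2 [p2 [pi1 pi2 p2i1 p1i2 _]]]]]] := sumA (asrc Y) (atgt X).
pose m : hom S (atgt Y) := amor Y \c p1 + (lval p).2 \c p2.
pose Z : B := AObj m.
have sq : @asquare _ _ Y Z (i1, idm (atgt Y)).
  rewrite /asquare /= mcomp1m /m compDl -!mcompA pi1 p2i1 compm0 addr0.
  by rewrite mcompm1.
pose c : hom Y Z := acls (ASq sq).
have cf : c \c acls p = 0.
  rewrite [LHS]acompE; apply/acls_eq0; exists i2; rewrite /= mcomp1m /m compDl -!mcompA.
  by rewrite p1i2 pi2 compm0 add0r mcompm1.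
have ce : epi c by exact: (@tgt_epi Y Z _ erefl).
exists Z, c; split.
  split=> // T u; have [r ->] := acls_surj u.
  rewrite [_ \c _]acompE => /acls_eq0[xi /= xiE].
  have sq' : @asquare _ _ Z T ((lval r).1 \c p1 + xi \c p2, (lval r).2).
    rewrite /asquare /= /m !compDr !mcompA xiE.
    by rewrite -(asqP r : _ \c _ = _ \c _).
  have vc : (acls (ASq sq') : hom Z T) \c c = acls r.
    rewrite [LHS]acompE; apply: acls_ext; rewrite /= ?mcompm1 //.
    by rewrite compDl -!mcompA pi1 p2i1 compm0 addr0 mcompm1.
  by exists (acls (ASq sq')); split=> // v' e; apply: ce; rewrite vc; exact: esym e.
split=> // F y; have [h ->] := pcl_surj y.
rewrite comp_pcl /= mcomp1m => /(@pcl_eq0 F Z)[xi /= <-].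
exists (@pcl F X (p2 \c xi)); rewrite comp_pcl.
rewrite /m compDl (linD (@pcl_linear F Y)).
rewrite mcompA -[RHS]add0r; congr (_ + _).
by apply/pcl_eq0; exists (p1 \c xi); rewrite mcompA.
Qed.

Lemma cokernel_elex X Y Z (f : hom X Y) (p : hom Y Z) : is_cokernel f p -> elex f p.
Proof.
move=> [pf cok]; have [Z' [c [[cf _] [_ ex]]]] := cokernel_exists f.
have [v [vp _]] := cok _ c cf.
by split=> // F y py; apply: ex; rewrite -vp -mcompA py compm0.
Qed.

(** Projectivity of [Proj F]: the cokernel map of an epimorphism is zero, so exactness there lifts
    every generalised element. *)
Lemma epi_lift X Y (f : hom X Y) F (y : hom (Proj F : B) Y) :
  epi f -> exists x, y = f \c x.
Proof.
move=> ef; have [Z [c [_ [cf ex]]]] := cokernel_exists f; apply: ex.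
suff -> : c = 0 by rewrite comp0m.
by apply: ef; rewrite cf comp0m.
Qed.

Lemma lift_epi X Y (f : hom X Y) :
  (forall F (y : hom (Proj F : B) Y), exists x, y = f \c x) -> epi f.
Proof.
move=> lf Z u v uv; apply: hom_ext => F y; have [x ->] := lf F y.
by rewrite !mcompA uv.
Qed.

Lemma ext_mono X Y (f : hom X Y) :
  (forall F (x : hom (Proj F : B) X), f \c x = 0 -> x = 0) -> mono f.
Proof.
move=> mf Z u v uv; apply: hom_ext => F x; apply/eqP; rewrite -subr_eq0.
by apply/eqP/mf; rewrite mcompBr !mcompA uv subrr.
Qed.

Lemma presentation_cokernel X : is_cokernel (pmap (amor X)) (cov X).
Proof.
split=> [|T w]; first by case: (presentation X).
have [h ->] := pcl_surj w; rewrite pcl_comp => /pcl_eq0[xi xiE].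
have sq : @asquare _ _ X T (xi, h) by rewrite /asquare /= xiE.
have e : (acls (ASq sq) : hom X T) \c cov X = pcl h.
  by rewrite comp_pcl mcompm1.
by exists (acls (ASq sq)); split=> // v vE; apply: (@cov_epi X); rewrite vE.
Qed.

(** The generators of [Z] lift to [Y] by projectivity; followed by [u] they respect the relations of
    [Z], hence induce [v]. The equality [v \c p = u] is checked on generalised elements. *)
Lemma elex_cokernel X Y Z (d : hom X Y) (p : hom Y Z) :
  elex d p -> epi p -> is_cokernel d p.
Proof.
move=> [pd ex] ep; split=> // T u ud.
have [y yE] := epi_lift (cov Z) ep.
have [cE _] := presentation Z.
have [|x xE] := ex _ (y \c pmap (amor Z)).
  by rewrite mcompA -yE cE.
have [_ cok] := presentation_cokernel Z.
have [|v [vE _]] := cok _ (u \c y).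
  by rewrite -mcompA xE mcompA ud comp0m.
suff vp : v \c p = u by exists v; split=> // w wE; apply: ep; rewrite vp wE.
apply: hom_ext => F t.
have [s sE] := pcl_surj (p \c t); have tE := pcl_cov s; rewrite -sE in tE.
have [|r rE] := ex _ (t - y \c pmap s).
  by rewrite mcompBr tE mcompA -yE subrr.
rewrite -mcompA tE mcompA vE; symmetry; apply/eqP; rewrite -subr_eq0.
by rewrite -mcompA -mcompBr rE mcompA ud comp0m.
Qed.

Lemma exact_elex X Y Z (f : hom X Y) (g : hom Y Z) : exact_at f g -> elex f g.
Proof.
move=> [K [i [f' [[gi ker] <- ef]]]]; split=> [|F y gy].
  by rewrite mcompA gi comp0m.
have [v [<- _]] := ker _ y gy; have [x ->] := epi_lift v ef.
by exists x; rewrite mcompA.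
Qed.

Lemma mono_epi_iso X Y (f : hom X Y) : mono f -> epi f -> is_iso f.
Proof.
move=> mf ef; have [|_ cok] := @elex_cokernel X X Y 0 f _ ef.
  split=> [|F y fy]; first by rewrite compm0.
  by exists 0; rewrite comp0m (mono0 mf fy).
have [|v [vf _]] := cok _ (idm X); first by rewrite compm0.
by exists v; split=> //; apply: ef; rewrite -mcompA vf mcompm1 mcomp1m.
Qed.

Lemma abar_zero : exists X : B, is_zero X.
Proof.
have [z z0] := zA; exists (Proj z); rewrite /is_zero -pcl_id z0; exact: pcl0.
Qed.

Lemma abar_dsum2 X Y : exists Z, is_dsum2 X Y Z.
Proof.
have [S /dsum2P[i [p [j [q [pi qj qi pj e]]]]]] := sumA (asrc X) (asrc Y).
have [S' /dsum2P[i' [p' [j' [q' [pi' qj' qi' pj' e']]]]]] := sumA (atgt X) (atgt Y).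
pose m : hom S S' := i' \c amor X \c p + j' \c amor Y \c q.
pose Z : B := AObj m.
have sqi : @asquare _ _ X Z (i, i').
  rewrite /asquare /= /m compDl -!mcompA pi qi !compm0 addr0.
  by rewrite mcompm1.
have sqj : @asquare _ _ Y Z (j, j').
  rewrite /asquare /= /m compDl -!mcompA pj qj !compm0 add0r.
  by rewrite mcompm1.
have sqp : @asquare _ _ Z X (p, p').
  rewrite /asquare /= /m compDr (mcompA p') pi' (mcompA p' j') pj' comp0m addr0.
  by rewrite mcomp1m.
have sqq : @asquare _ _ Z Y (q, q').
  rewrite /asquare /= /m compDr (mcompA q') qi' (mcompA q' j') qj' comp0m add0r.
  by rewrite mcomp1m.
exists Z; apply/dsum2P; exists (acls (ASq sqi)), (acls (ASq sqp)).
exists (acls (ASq sqj)), (acls (ASq sqq)); split.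
- by rewrite [LHS]acompE; apply: acls_ext.
- by rewrite [LHS]acompE; apply: acls_ext.
- by rewrite [LHS]acompE; apply/acls_eq0; exists 0; rewrite compm0 /= qi'.
- by rewrite [LHS]acompE; apply/acls_eq0; exists 0; rewrite compm0 /= pj'.
- rewrite [X in X + _ = _]acompE [X in _ + X = _]acompE.
  by rewrite -[LHS]lclsD; apply: acls_ext.
Qed.

Lemma abar_split : split_idempotents B.
Proof.
move=> X e ee; have [Z [c [[ce cok] _]]] := cokernel_exists (idm X - e).
have cE : c \c e = c by apply/esym/eqP; rewrite -subr_eq0 -{1}[c]mcompm1 -mcompBr ce.
have [|i [ic _]] := cok _ e; first by rewrite mcompBr mcompm1 ee subrr.
exists Z, c, i; split=> //; apply: (@cokernel_epi _ _ _ _ _ (idm X - e) c) => //.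
by rewrite -mcompA ic cE mcomp1m.
Qed.

Lemma Proj_retract F G : retract (Proj F : B) (Proj G) <-> retract F G.
Proof.
split=> [[i [p]]|[i [p pi]]]; last first.
  by exists (pmap i), (pmap p); rewrite pcl_comp pi pcl_id.
have [i' ->] := pcl_surj i; have [p' ->] := pcl_surj p.
rewrite pcl_comp -pcl_id => /eqP; rewrite -subr_eq0 => /eqP e.
have : pcl (p' \c i' - idm F) = 0 :> hom (Proj F : B) (Proj F).
  by rewrite -[RHS]e -scaleN1r addrC pcl_linear scaleN1r addrC.
move=> /(@pcl_eq0 F (Proj F))[xi]; rewrite /= comp0m => /esym/eqP.
by rewrite subr_eq0 => /eqP pi; exists i', p'.
Qed.

Lemma Proj_indecomposable F : indecomposable F -> indecomposable (Proj F : B).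
Proof.
have inj (h : hom F F) : pmap h = 0 -> h = 0.
  by move=> /(@pcl_eq0 F (Proj F))[xi]; rewrite /= comp0m.
move=> Fi; split=> [|Y Z /dsum2P[i [p [j [q [pi qj qi pj e]]]]]].
  by rewrite /is_zero -pcl_id => /inj; case: Fi.
have [f fE] := pcl_surj (i \c p).
have [|f0|f1] := @indecomposable_idempotent _ _ spA F f Fi.
- apply/eqP; rewrite -subr_eq0; apply/eqP/inj.
  rewrite -scaleN1r addrC pcl_linear scaleN1r addrC -pcl_comp -fE.
  by rewrite -mcompA (mcompA p) pi mcomp1m subrr.
- left; rewrite f0 (@pcl0 F (Proj F)) in fE.
  by rewrite /is_zero -pi -[i]mcompm1 -pi (mcompA i) fE comp0m compm0.
- right; rewrite f1 pcl_id in fE.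
  by rewrite /is_zero -qj -[j]mcomp1m -fE -mcompA pj !compm0.
Qed.

End Abelianisation.

(** * Kernels, images and simple heads in the abelianisation *)

Section AbelianStructure.
Variables (k : fieldType) (A : lincat k).
Hypothesis hA : finitary_cat A.
Local Notation B := (abar A).
Local Notation pmap g := (@pcl _ _ _ (Proj _) g).
Implicit Types (F : A) (X Y Z : B).

(** [t] is the copairing out of the direct sum of the [F a]; built from the [x a] by sums and
    precompositions, it stays in every right ideal containing them. *)
Lemma family_cover X n (F : 'I_n -> A) (x : forall a, hom (Proj (F a) : B) X) :
  exists W (t : hom (Proj W : B) X), (forall a, exists h, x a = t \c h) /\
  forall N : forall E, hom E X -> Prop,
    right_ideal N -> (forall a, N _ (x a)) -> N _ t.
Proof.
have [[[z z0] sumA _] _ _] := hA.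
elim: n F x => [|n IH] F x.
  by exists z, 0; split=> [[]//|N [N0 _ _] _]; exact: N0.
have [W [t [tx tN]]] := IH _ (fun a => x (lift ord0 a)).
have [S /dsum2P[i [p [j [q [pi qj qi pj _]]]]]] := sumA (F ord0) W.
have p1 F' (h : hom F' F') : h = idm F' -> pmap h = idm (Proj F' : B).
  by move=> ->; exact: pcl_id.
exists S, (x ord0 \c pmap p + t \c pmap q); split=> [a|N rN Nx].
  case: (unliftP ord0 a) => [b ->|->].
    have [h ->] := tx b; exists (pmap j \c h).
    rewrite mcompA compDl -!(mcompA _ (pmap _)) !pcl_comp pj (p1 _ _ qj).
    by rewrite pcl0 compm0 add0r mcompm1.
  exists (pmap i); rewrite compDl -!mcompA !pcl_comp qi (p1 _ _ pi).
  by rewrite pcl0 compm0 addr0 mcompm1.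
have [N0 NZD Nc] := rN.
by rewrite -[_ \c pmap p]scale1r; apply: NZD; apply: Nc; last exact: tN.
Qed.

(** Right ideals are finitely generated: on each of the finitely many indecomposables the values
    form a finite-dimensional space, and the spanning families merge into one [t]. Other objects are
    reached by decomposition. *)
Lemma right_ideal_cover X (N : forall E, hom E X -> Prop) : right_ideal N ->
  exists W (t : hom (Proj W : B) X), N _ t /\
    forall F (x : hom (Proj F : B) X), N _ x -> exists h, x = t \c h.
Proof.
move=> rN; have [N0 NZD Nc] := rN; have [[_ _ spA] fdA [n [s sP]]] := hA.
have cov1 a : exists W (t : hom (Proj W : B) X), N _ t /\
    forall x : hom (Proj (s a) : B) X, N _ x -> exists h, x = t \c h.
  have [m [e eS]] := fin_dim_spans (abar_fin_dim hA (Proj (s a)) X).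
  have [m' [x [xN xS]]] := sub_spans (U := Submod (N0 _) (NZD _)) (fun v _ => eS v I).
  have [W [t [tx tN]]] := @family_cover X m' (fun=> s a) x.
  exists W, t; split=> [|y Ny]; first exact: tN.
  have [c ->] := xS y Ny; pose h b := sval (cid (tx b)).
  exists (\sum_b c b *: h b); rewrite comp_sumr; apply: eq_bigr => b _.
  by rewrite compZr -(svalP (cid (tx b))).
pose W a := sval (cid (cov1 a)).
pose t a : hom (Proj (W a) : B) X := sval (cid (svalP (cid (cov1 a)))).
have tP a : N _ (t a) /\ forall x : hom (Proj (s a) : B) X, N _ x -> exists h, x = t a \c h.
  exact: (svalP (cid (svalP (cid (cov1 a))))).
have [V [u [ut uN]]] := family_cover t.
exists V, u; split=> [|F x Nx]; first by apply: uN => // a; case: (tP a).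
suff tl E (g : hom E F) : thru (@indecomposable k A) g -> exists h, x \c pmap g = u \c h.
  have [|h] := tl _ (idm F).
    have dF := thru_indecomposable fdA F.
    by apply: thru_trans dF => y [yi _]; exact: thru_obj.
  by rewrite pcl_id // mcompm1 => ->; exists h.
move=> tg; elim: tg x Nx => {E F g} [E F|E F f g _ IH _ IH'|E y F f g yi] x Nx.
- by exists 0; rewrite pcl0 !compm0.
- have [h hE] := IH x Nx; have [h' hE'] := IH' x Nx; exists (h + h').
  by rewrite (linD (@pcl_linear _ _ _ _)) !compDr hE hE'.
- have [a [c [c' [c'c cc']]]] := sP y yi.
  have [_ /(_ (x \c pmap (f \c c')) (Nc _ _ _ _ Nx))[h hE]] := tP a.
  have [h' hE'] := ut a.
  exists (h' \c h \c pmap (c \c g)).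
  rewrite mcompA mcompA -hE' -hE -mcompA pcl_comp.
  by rewrite -mcompA (mcompA c') c'c mcomp1m.
Qed.

Lemma annihilator_ideal X Y (f : hom X Y) : right_ideal (fun E (u : hom E X) => f \c u = 0).
Proof.
split=> [E|E c u v fu fv|E E' u g fu]; first exact: compm0.
  by rewrite compDr compZr fu fv scaler0 addr0.
by rewrite mcompA fu comp0m.
Qed.

Lemma weak_kernel X Y (f : hom X Y) :
  exists W (t : hom (Proj W : B) X), elex t f.
Proof. by have [W [t [ft h]]] := right_ideal_cover (annihilator_ideal f); exists W, t. Qed.

Lemma epi_factor X Y Z (q : hom X Y) (f : hom X Z) : epi q ->
  (forall F (x : hom (Proj F : B) X), q \c x = 0 -> f \c x = 0) ->
  exists g, f = g \c q.
Proof.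
move=> eq qf; have [W [t tq]] := weak_kernel q.
have [_ cok] := elex_cokernel hA tq eq.
by have [|g [<- _]] := cok _ f; [apply/qf; case: tq | exists g].
Qed.

(** The weak kernel [t] covers the kernel; dividing its source by the weak kernel [s] of [t] makes
    the induced [i] a monomorphism. *)
Lemma kernel_exists X Y (f : hom X Y) :
  exists K (i : hom K X), mono i /\ is_kernel f i.
Proof.
have [W [t tf]] := weak_kernel f; have [V [s st]] := weak_kernel t.
have [K [c [cokc [cs cex]]]] := cokernel_exists hA s.
have [_ cok] := cokc; have ec := cokernel_epi cokc.
have [|i [ic _]] := cok _ t; first by case: st.
have mi : mono i.
  apply: ext_mono => F x ix; have [w xE] := epi_lift hA x ec.
  have [_ /(_ F w)[|v vE]] := st; first by rewrite -ic -mcompA -xE.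
  by rewrite xE vE mcompA cs comp0m.
exists K, i; split=> //; split=> [|T u fu].
  by apply: ec; rewrite -mcompA ic comp0m; case: tf.
suff [v vE] : exists v, i \c v = u.
  by exists v; split=> // w wE; apply: mi; rewrite vE wE.
have [_ /(_ _ (u \c cov T))[|h hE]] := tf; first by rewrite mcompA fu comp0m.
have [|g gE] := @epi_factor _ _ _ (cov T) (c \c h) (cov_epi (X := T)).
  move=> F x Tx; apply: (mono0 mi).
  by rewrite mcompA mcompA ic -hE -mcompA Tx compm0.
by exists g; apply: (@cov_epi _ _ T); rewrite -mcompA -gE mcompA ic hE.
Qed.

Lemma elex_exact X Y Z (f : hom X Y) (g : hom Y Z) : elex f g -> exact_at f g.
Proof.
move=> [gf ex]; have [K [i [mi ker]]] := kernel_exists g.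
have [gi kerU] := ker; have [f' [f'E _]] := kerU _ f gf.
exists K, i, f'; split=> //; apply: (lift_epi) => F y.
have [|x xE] := ex F (i \c y); first by rewrite mcompA gi comp0m.
by exists x; apply: mi; rewrite mcompA f'E.
Qed.

(** Trades the kernel-based exactness for a universal property, which left adjoints preserve. *)
Lemma resolution_cokernel X Y Z (f : hom X Y) (p : hom Y Z) :
  exact_at f p /\ epi p <-> is_cokernel f p.
Proof.
split=> [[/(exact_elex hA)ex ep]|cok]; first exact: elex_cokernel.
by split; [apply: elex_exact; exact: cokernel_elex | exact: cokernel_epi cok].
Qed.

Lemma image_exists X Y (f : hom X Y) :
  exists I (q : hom X I) (i : hom I Y), [/\ epi q, mono i & f = i \c q].
Proof.
have [Z [c [_ [cf ex]]]] := cokernel_exists hA f.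
have [I [i [mi [ci ker]]]] := kernel_exists c; have [q [qE _]] := ker _ f cf.
exists I, q, i; split=> //; apply: lift_epi => F y.
have [|x xE] := ex F (i \c y); first by rewrite mcompA ci comp0m.
by exists x; apply: mi; rewrite mcompA qE.
Qed.

Lemma simple_epi X Y (f : hom X Y) : simple Y -> f <> 0 -> epi f.
Proof.
move=> [_ sY] f0; have [I [q [i [eq mi fE]]]] := image_exists f.
have [I0|ii] := sY _ i mi; first by case: f0; rewrite fE (zero_from i I0) comp0m.
by rewrite fE; apply: epi_comp => //; exact: iso_epi.
Qed.

(** These are the morphisms that are not split epimorphisms; closure under sums is locality of the
    endomorphism ring. *)
Lemma radical_ideal F : indecomposable F -> right_ideal
  (fun E (u : hom E (Proj F : B)) => forall s : hom (Proj F : B) E, ~ is_iso (u \c s)).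
Proof.
move=> Fi; have [PF0 _] := Proj_indecomposable hA Fi.
split=> [E s|E c u v nu nv s|E E' u g nu s].
- by rewrite comp0m => -[g [_]]; rewrite comp0m => e; apply: PF0.
- rewrite compDl => /(local_add (abar_split hA) (@abar_fin_dim _ _ hA)) [].
  + exact: Proj_indecomposable.
  + by rewrite compZl -compZr; exact: nu.
  + exact: nv.
- by rewrite -mcompA; exact: nu.
Qed.

(** [L] is [Proj F] modulo its radical. What survives in [L] comes from split epimorphisms onto
    [Proj F], so a nonzero subobject of [L] is everything. *)
Lemma simple_head_exists F : indecomposable F ->
  exists L (q : hom (Proj F : B) L), [/\ simple L, epi q
    & forall E (x : hom (Proj E : B) (Proj F)), q \c x <> 0 ->
        exists s : hom (Proj F : B) (Proj E), is_iso (x \c s)].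
Proof.
move=> Fi; have [W [t [rt tr]]] := right_ideal_cover (radical_ideal Fi).
have [L [q [cokq [qt ex]]]] := cokernel_exists hA t.
have eq := cokernel_epi cokq.
have qx E (x : hom (Proj E : B) (Proj F)) : q \c x <> 0 ->
    exists s : hom (Proj F : B) (Proj E), is_iso (x \c s).
  move=> qx0; apply: contrapT => /forallNP nx.
  by case: qx0; have [h ->] := tr E x nx; rewrite mcompA qt comp0m.
exists L, q; split=> //; split=> [L0|U u mu].
  have [|h hE] := ex F (idm _); first by rewrite mcompm1 (zero_to q).
  by apply: (rt h); rewrite -hE; exact: iso_id.
case: (pselect (is_zero U)) => [|U0]; [by left | right].
have cU : cov U <> 0 by move/(epi0 (@cov_epi _ _ U)).
have [x xE] := epi_lift hA (u \c cov U) eq.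
have [|s [v [_ xsv]]] := qx _ x.
  by rewrite -xE => /(mono0 mu).
apply: (mono_epi_iso hA) => // T a b ab; apply: eq.
rewrite -[q]mcompm1 -xsv -!mcompA !(mcompA q) -xE -!mcompA !(mcompA a) !(mcompA b).
by rewrite ab.
Qed.

(** The kernel of [q] lies in the radical, since a split epimorphism killed by [q] would force [Y]
    to vanish; so the map onto the head factors through [q]. *)
Lemma simple_quotient F Y (q : hom (Proj F : B) Y) : indecomposable F -> epi q ->
  ~ is_zero Y -> exists L (r : hom Y L), simple L /\ epi r.
Proof.
move=> Fi eq Y0; have [L [p [sL ep hp]]] := simple_head_exists Fi.
have [|r rE] := @epi_factor _ _ _ q p eq.
  move=> E x qx; apply: contrapT => /hp[s [v [_ xsv]]]; apply: Y0.
  by apply: (epi0 eq); rewrite -[q]mcompm1 -xsv -!mcompA mcompA qx comp0m.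
exists L, r; split=> // Z u v uv; apply: ep.
by rewrite rE !mcompA uv.
Qed.

Lemma abar_power Q n : exists Y, is_dsum (fun _ : 'I_n => Q) Y.
Proof.
elim: n => [|n [Y [inj [prj [h1 h2 h3]]]]].
  have [Z Z0] := abar_zero hA; exists Z, (fun=> 0), (fun=> 0).
  by split=> [[]//|[]//|]; rewrite big_ord0 Z0.
have [Z /dsum2P[i [p [j [q [pi qj qi pj e]]]]]] := abar_dsum2 hA Q Y.
exists Z, (fun a => if unlift ord0 a is Some b then j \c inj b else i).
exists (fun a => if unlift ord0 a is Some b then prj b \c q else p); split.
- move=> a; case: unliftP => // b _.
  by rewrite -mcompA (mcompA q) qj mcomp1m.
- move=> a b ab; case: (unliftP ord0 a) => [a' aE|aE];
    case: (unliftP ord0 b) => [b' bE|bE]; rewrite ?mcompA ?pj ?comp0m //.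
  + rewrite -(mcompA (prj b')) qj mcompm1 h2 //.
    by apply: contra ab => /eqP e'; rewrite aE bE e'.
  + by rewrite -mcompA qi compm0.
  + by rewrite aE bE eqxx in ab.
- rewrite big_ord_recl unlift_none -e; congr (_ + _).
  under eq_bigr => a _ do rewrite liftK -mcompA (mcompA (inj a)).
  by rewrite -comp_sumr -comp_suml h3 mcomp1m.
Qed.

(** In this form membership in $\mathrm{add}(Q)$ is transported by functors through [thru_fmap],
    with no direct sum in sight. *)
Lemma in_addP Q X : in_add Q X <-> thru (fun Y => Y = Q) (idm X).
Proof.
split=> [[n [Y [dY /summand_retract XY]]]|/thru_eqP[n [g [h e]]]].
  by apply: (thru_retract XY); apply: (thru_dsum dY) => _; exact: thru_obj.
have [Y dY] := abar_power Q n; exists n, Y; split=> //.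
apply: (retract_summand (abar_split hA)).
have [inj [prj [h1 h2 h3]]] := dY.
exists (\sum_a inj a \c h a), (\sum_a g a \c prj a).
rewrite comp_suml e; apply: eq_bigr => a _.
rewrite comp_sumr (bigD1 a) //= big1 ?addr0 => [|b ba].
  by rewrite -mcompA (mcompA (prj a)) h1 mcomp1m.
by rewrite -mcompA (mcompA (prj a)) h2 // comp0m compm0.
Qed.

End AbelianStructure.

(** * Adjunctions *)

Section Functors.
Variables (k : fieldType) (A B : lincat k) (F : functor A B).

Lemma fmap0 x y : fmap F (0 : hom x y) = 0.
Proof. exact: (lin0 (@fmap_lin _ _ _ F x y)). Qed.

Lemma fmap_zero x : is_zero x -> is_zero (F x).
Proof. by move=> x0; rewrite /is_zero -fmap1 x0 fmap0. Qed.

Lemma fmap_retract x y : retract x y -> retract (F x) (F y).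
Proof. by move=> [i [p pi]]; exists (fmap F i), (fmap F p); rewrite -fmapM pi fmap1. Qed.

Lemma afun_Proj (hA : finitary_cat A) (hB : finitary_cat B) E :
  isomorphic (afun F (Proj E)) (Proj (F E) : abar B).
Proof.
have sq1 : @asquare _ _ (afun F (Proj E)) (Proj (F E)) (0, idm (F E)).
  by rewrite /asquare /= fmap0 !compm0.
have sq2 : @asquare _ _ (Proj (F E)) (afun F (Proj E)) (0, idm (F E)).
  by rewrite /asquare /= fmap0 !compm0.
exists (acls (ASq sq1)), (acls (ASq sq2)).
split; rewrite [LHS]acompE; apply: acls_ext; rewrite /= ?mcomp1m ?comp0m //.
  by symmetry; apply: fmap_zero; exact: (zero_objP hA).
by symmetry; exact: (zero_objP hB).
Qed.

End Functors.

Definition is_adj (k : fieldType) (A B : lincat k)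
    (F : functor A B) (G : functor B A) :=
  exists (eta : forall x, hom x (G (F x))) (eps : forall y, hom (F (G y)) y),
  [/\ forall x y (f : hom x y), eta y \c f = fmap G (fmap F f) \c eta x,
      forall x y (f : hom x y), eps y \c fmap F (fmap G f) = f \c eps x,
      forall x, eps (F x) \c fmap F (eta x) = idm (F x)
    & forall y, fmap G (eps y) \c eta (G y) = idm (G y)].

Section Adjunctions.
Variables (k : fieldType) (A B : lincat k) (F : functor A B) (G : functor B A).

Hypothesis adj : is_adj F G.

Lemma adj_epi x y (f : hom x y) : epi f -> epi (fmap F f).
Proof.
have [eta [eps [ne nf t1 t2]]] := adj; move=> ef z u v uv.
have r (w : hom (F y) z) : w = eps z \c fmap F (fmap G w \c eta y).
  by rewrite fmapM mcompA nf -mcompA t1 mcompm1.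
rewrite (r u) (r v); congr (_ \c fmap F _); apply: ef.
by rewrite -!mcompA ne !mcompA -!fmapM uv.
Qed.

Lemma adj_mono x y (f : hom x y) : mono f -> mono (fmap G f).
Proof.
have [eta [eps [ne nf t1 t2]]] := adj; move=> mf z u v uv.
have r (w : hom z (G x)) : w = fmap G (eps x \c fmap F w) \c eta z.
  by rewrite fmapM -mcompA -ne mcompA t2 mcomp1m.
rewrite (r u) (r v); congr (fmap G _ \c _); apply: mf.
by rewrite !mcompA -!nf -!mcompA -!fmapM uv.
Qed.

Lemma adj_cokernel x y z (f : hom x y) (p : hom y z) :
  is_cokernel f p -> is_cokernel (fmap F f) (fmap F p).
Proof.
have [eta [eps [ne nf t1 t2]]] := adj; move=> cok; have [pf h] := cok.
have eFp := adj_epi (cokernel_epi cok).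
split=> [|t u uf]; first by rewrite -fmapM pf fmap0.
have [|v [vp _]] := h _ (fmap G u \c eta y).
  by rewrite -mcompA ne mcompA -fmapM uf fmap0 comp0m.
have e : (eps t \c fmap F v) \c fmap F p = u.
  by rewrite -mcompA -fmapM vp fmapM mcompA nf -mcompA t1 mcompm1.
by exists (eps t \c fmap F v); split=> // w wp; apply: eFp; rewrite e wp.
Qed.

Lemma adj_nonzero_l x y (f : hom x (G y)) : f <> 0 -> exists g : hom (F x) y, g <> 0.
Proof.
have [eta [eps [ne nf t1 t2]]] := adj; move=> f0; exists (eps y \c fmap F f) => g0.
by apply: f0; rewrite -[f]mcomp1m -t2 -mcompA ne mcompA -fmapM g0 fmap0 comp0m.
Qed.

Lemma adj_nonzero_r x y (g : hom (F x) y) : g <> 0 -> exists f : hom x (G y), f <> 0.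
Proof.
have [eta [eps [ne nf t1 t2]]] := adj; move=> g0; exists (fmap G g \c eta x) => f0.
by apply: g0; rewrite -[g]mcompm1 -t1 mcompA -nf -mcompA -fmapM f0 fmap0 compm0.
Qed.

(** The involution squares to the identity only up to isomorphism: the right adjoint of $F^{*}$
    comes out as $F^{**}$ and has to be replaced by $F$. *)
Lemma adj_iso_right (G' : functor B A) (t : forall y, hom (G y) (G' y))
    (t' : forall y, hom (G' y) (G y)) :
  natural t -> (forall y, t' y \c t y = idm _) -> (forall y, t y \c t' y = idm _) ->
  is_adj F G'.
Proof.
have [eta [eps [ne nf t1 t2]]] := adj; move=> nt tK tK'.
have nt' x y (f : hom x y) : t' y \c fmap G' f = fmap G f \c t' x.
  by rewrite -[fmap G' f]mcompm1 -tK' (mcompA (fmap G' f)) -nt !mcompA tK mcomp1m.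
exists (fun x => t _ \c eta x), (fun y => eps y \c fmap F (t' y)); split.
- by move=> x y f; rewrite -mcompA ne !mcompA nt.
- by move=> x y f; rewrite -mcompA -fmapM nt' fmapM !mcompA nf.
- by move=> x; rewrite -mcompA -fmapM mcompA tK mcomp1m.
- move=> y; rewrite mcompA -nt fmapM -!mcompA -ne (mcompA (fmap G _)) t2.
  by rewrite mcomp1m tK'.
Qed.

Lemma afun_adj : is_adj (afun F) (afun G).
Proof.
have [eta [eps [ne nf t1 t2]]] := adj.
have sqe (X : abar A) : @asquare _ _ X (afun G (afun F X)) (eta _, eta _).
  by rewrite /asquare /= ne.
have sqf (Y : abar B) : @asquare _ _ (afun F (afun G Y)) Y (eps _, eps _).
  by rewrite /asquare /= nf.
exists (fun X => acls (ASq (sqe X))), (fun Y => acls (ASq (sqf Y))).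
split=> [X Y f|X Y f|X|Y].
- have [p ->] := acls_surj f; rewrite /= !afmapE [LHS]acompE [RHS]acompE.
  by apply: (@acls_ext _ _ X (afob G (afob F Y))); rewrite /= ne.
- have [p ->] := acls_surj f; rewrite /= !afmapE [LHS]acompE [RHS]acompE.
  by apply: (@acls_ext _ _ (afob F (afob G X)) Y); rewrite /= nf.
- by rewrite /= afmapE [LHS]acompE; apply: (@acls_ext _ _ (afob F X) (afob F X));
  rewrite /= t1.
- by rewrite /= afmapE [LHS]acompE; apply: (@acls_ext _ _ (afob G Y) (afob G Y));
  rewrite /= t2.
Qed.

End Adjunctions.

(** * Whiskering adjunctions in a strict 2-category *)

Section StrictEqualities.
Variables (k : fieldType) (A : lincat k).

(* Equality of morphisms whose endpoints are only propositionally equal. *)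
Definition hsim (x y x' y' : A) (f : hom x y) (g : hom x' y') :=
  exists (ex : x = x') (ey : y = y'), eqm ey \c f = g \c eqm ex.

Lemma eqm_refl (x : A) (e : x = x) : eqm e = idm x.
Proof. by rewrite (Prop_irrelevance e erefl). Qed.

Lemma hsim_eq (x y : A) (f g : hom x y) : hsim f g -> f = g.
Proof. by move=> [ex [ey]]; rewrite !eqm_refl mcomp1m mcompm1. Qed.

Lemma hsim_refl (x y : A) (f : hom x y) : hsim f f.
Proof. by exists erefl, erefl; rewrite /= mcomp1m mcompm1. Qed.

Lemma hsim_sym (x y x' y' : A) (f : hom x y) (g : hom x' y') : hsim f g -> hsim g f.
Proof.
move=> [ex [ey]]; case: _ / ex g; case: _ / ey => g /=.
by rewrite mcomp1m mcompm1 => ->; exact: hsim_refl.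
Qed.

Lemma hsim_trans (x y x' y' x2 y2 : A) (f : hom x y) (g : hom x' y') (h : hom x2 y2) :
  hsim f g -> hsim g h -> hsim f h.
Proof.
move=> [ex [ey]]; case: _ / ex g; case: _ / ey => g /=.
by rewrite mcomp1m mcompm1 => ->.
Qed.

Lemma hsim_comp (x y z x' y' z' : A) (f : hom x y) (g : hom y z)
    (f' : hom x' y') (g' : hom y' z') :
  hsim g g' -> hsim f f' -> hsim (g \c f) (g' \c f').
Proof.
move=> [ey [ez]]; case: _ / ey g' f'; case: _ / ez => g' f' /=.
rewrite mcomp1m mcompm1 => -> [ex [ey]]; case: _ / ex f' => f'.
by rewrite eqm_refl /= mcomp1m mcompm1 => ->; exact: hsim_refl.
Qed.

Lemma hsim_eqml (x y z : A) (e : y = z) (f : hom x y) : hsim (eqm e \c f) f.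
Proof. by case: _ / e; rewrite /= mcomp1m; exact: hsim_refl. Qed.

Lemma hsim_eqmr (x y z : A) (e : x = y) (f : hom y z) : hsim (f \c eqm e) f.
Proof. by case: _ / e f => f; rewrite /= mcompm1; exact: hsim_refl. Qed.

End StrictEqualities.

Section HorizontalComposition.
Variables (k : fieldType) (C : twocat k).

Lemma hsim_hcomp (i j l : C) (F F' F1 F1' : C j l) (G G' G1 G1' : C i j)
    (a : hom F F') (a1 : hom F1 F1') (b : hom G G') (b1 : hom G1 G1') :
  hsim a a1 -> hsim b b1 -> hsim (a \o2 b) (a1 \o2 b1).
Proof.
move=> [e [e']]; case: _ / e a1; case: _ / e' => a1 /=.
rewrite mcomp1m mcompm1 => -> [e [e']]; case: _ / e b1; case: _ / e' => b1 /=.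
by rewrite mcomp1m mcompm1 => ->; exact: hsim_refl.
Qed.

Lemma hsim_hcompA (i j l m : C) (F F' : C l m) (G G' : C j l) (H H' : C i j)
    (a : hom F F') (b : hom G G') (c : hom H H') :
  hsim (a \o2 (b \o2 c)) ((a \o2 b) \o2 c).
Proof. by exists (comp1A F G H), (comp1A F' G' H'); exact: hcomp2A. Qed.

Lemma hsim_hcomp1l (i j : C) (F F' : C i j) (a : hom F F') :
  hsim (idm (one1 j) \o2 a) a.
Proof. by exists (comp1_1l F), (comp1_1l F'); exact: hcomp2_1l. Qed.

(** Unit and counit are [beta] and [alpha] whiskered by [H]. Strict associativity and unitality
    enter only as transports, which [hsim] absorbs; what remains of the triangle identities is
    [adj1] and [adj2] whiskered by [H]. *)
Lemma lcomp_adj (i0 i j : C) (F : C i j) (F' : C j i) alpha beta :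
  @adjunction _ C i j F F' alpha beta -> is_adj (lcomp i0 F) (lcomp i0 F').
Proof.
move=> [adj1 adj2].
pose eta (H : C i0 i) : hom H (F' \o1 (F \o1 H)) :=
  eqm (esym (comp1A F' F H)) \c ((beta \o2 idm H) \c eqm (esym (comp1_1l H))).
pose eps (K : C i0 j) : hom (F \o1 (F' \o1 K)) K :=
  eqm (comp1_1l K) \c ((alpha \o2 idm K) \c eqm (comp1A F F' K)).
have etaE H : hsim (eta H) (beta \o2 idm H).
  exact: hsim_trans (hsim_eqml _ _) (hsim_eqmr _ _).
have epsE K : hsim (eps K) (alpha \o2 idm K).
  exact: hsim_trans (hsim_eqml _ _) (hsim_eqmr _ _).
have idA (j' l m : C) (a : C l m) (b : C j' l) (H H' : C i0 j') (c : hom H H') :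
    hsim (idm a \o2 (idm b \o2 c)) (idm (a \o1 b) \o2 c).
  by rewrite -hcomp2_id; exact: hsim_hcompA.
have Aid (j' l m : C) (G G' : C l m) (a : hom G G') (b : C j' l) (H : C i0 j') :
    hsim (a \o2 idm (b \o1 H)) ((a \o2 idm b) \o2 idm H).
  by rewrite -hcomp2_id; exact: hsim_hcompA.
have id1 (j' l : C) (G G' : C j' l) (H : C i0 j') (e : G = G') :
    hsim (eqm e \o2 idm H) (idm (G \o1 H)).
  by case: _ / e; rewrite /= hcomp2_id; exact: hsim_refl.
exists eta, eps; split.
- move=> H K b; apply: hsim_eq => /=.
  apply: (hsim_trans (hsim_comp (etaE K) (hsim_sym (hsim_hcomp1l b)))).
  apply: hsim_trans (hsim_comp (hsim_sym (idA _ _ _ F' F _ _ b)) (hsim_sym (etaE H))).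
  by rewrite -!interchange !mcomp1m !mcompm1; exact: hsim_refl.
- move=> H K b; apply: hsim_eq => /=.
  apply: (hsim_trans (hsim_comp (epsE K) (idA _ _ _ F F' _ _ b))).
  apply: hsim_trans (hsim_comp (hsim_hcomp1l b) (hsim_sym (epsE H))).
  by rewrite -!interchange !mcomp1m !mcompm1; exact: hsim_refl.
- move=> H; apply: hsim_eq => /=.
  have T : hsim (((eqm (comp1_1l F) \c (alpha \o2 idm F)) \o2 idm H)
      \c ((eqm (comp1A F F' F) \c (idm F \o2 beta)) \o2 idm H)) (idm (F \o1 H)).
    rewrite -interchange mcomp1m -mcompA adj1.
    by apply: hsim_trans (id1 _ _ _ _ H (comp1_1r F)) _; rewrite comp1_1r; exact: hsim_refl.
  apply: hsim_trans T; apply: hsim_comp.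
    apply: hsim_trans (epsE _) _; apply: hsim_trans (Aid _ _ _ _ _ alpha F H) _.
    by apply: hsim_hcomp (hsim_sym (hsim_eqml _ _)) (hsim_refl _).
  apply: hsim_trans (hsim_hcomp (hsim_refl _) (etaE H)) _.
  apply: hsim_trans (hsim_hcompA _ _ _) _.
  by apply: hsim_hcomp (hsim_sym (hsim_eqml _ _)) (hsim_refl _).
- move=> H; apply: hsim_eq => /=.
  have T : hsim (((eqm (comp1_1r F') \c (idm F' \o2 alpha)) \o2 idm H)
      \c ((eqm (esym (comp1A F' F F')) \c (beta \o2 idm F')) \o2 idm H))
      (idm (F' \o1 H)).
    rewrite -interchange mcomp1m -mcompA adj2.
    by apply: hsim_trans (id1 _ _ _ _ H (comp1_1l F')) _; rewrite comp1_1l; exact: hsim_refl.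
  apply: hsim_trans T; apply: hsim_comp.
    apply: hsim_trans (hsim_hcomp (hsim_refl _) (epsE H)) _.
    apply: hsim_trans (hsim_hcompA _ _ _) _.
    by apply: hsim_hcomp (hsim_sym (hsim_eqml _ _)) (hsim_refl _).
  apply: hsim_trans (etaE _) _; apply: hsim_trans (Aid _ _ _ _ _ beta F' H) _.
  by apply: hsim_hcomp (hsim_sym (hsim_eqml _ _)) (hsim_refl _).
Qed.

End HorizontalComposition.

(** * Presentable objects as modules *)

Lemma ff_surj_equivalent (k : fieldType) (A B : lincat k) (F : functor A B) :
  (forall x y (f g : hom x y), fmap F f = fmap F g -> f = g) ->
  (forall x y (h : hom (F x) (F y)), exists f, fmap F f = h) ->
  (forall z, exists x, isomorphic (F x) z) -> equivalent A B.
Proof.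
move=> faithful full surj.
pose fl x y (h : hom (F x) (F y)) : hom x y := sval (cid (full x y h)).
have flE x y (h : hom (F x) (F y)) : fmap F (fl x y h) = h := svalP (cid (full x y h)).
pose g z := sval (cid (surj z)).
pose t z : hom (F (g z)) z := sval (cid (svalP (cid (surj z)))).
have ti z : is_iso (t z) := svalP (cid (svalP (cid (surj z)))).
pose s z : hom z (F (g z)) := sval (cid (ti z)).
have [st ts] : (forall z, s z \c t z = idm _) /\ (forall z, t z \c s z = idm _).
  by split=> z; case: (svalP (cid (ti z))).
pose gm y z (h : hom y z) := fl _ _ (s z \c h \c t y).
have gmE y z (h : hom y z) : fmap F (gm y z h) = s z \c h \c t y by exact: flE.
have glin y z : linear (gm y z).
  move=> c u v; apply: faithful; rewrite fmap_lin !gmE.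
  by rewrite mcomp_linl mcomp_linr.
have g1 z : gm z z (idm z) = idm (g z).
  by apply: faithful; rewrite gmE fmap1 mcomp1m st.
have gM x y z (h : hom y z) (h' : hom x y) : gm x z (h \c h') = gm y z h \c gm x y h'.
  apply: faithful; rewrite fmapM !gmE -!mcompA; congr (_ \c (_ \c _)).
  by rewrite (mcompA (t y)) ts mcomp1m.
pose Gf := @Functor _ B A g gm glin g1 gM.
exists F, Gf; split.
- exists (fun x => fl (Gf (F x)) x (t (F x))); split=> [x|x y f].
    exists (fl x (Gf (F x)) (s (F x))).
    by split; apply: faithful; rewrite fmapM !flE fmap1.
  apply: faithful; rewrite !fmapM !flE -[RHS]mcomp1m -ts.
  exact: mcompA.
- exists t; split=> [z|y z h]; first exact: ti.
  by rewrite (gmE _ _ h) -[RHS]mcomp1m -ts; exact: mcompA.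
Qed.

Section VectorStructures.
Variable k : fieldType.

Definition vect_of (V : lmodType k) (h : fin_dim V) : vectType k :=
  HB.pack V (Lmodule_hasFinDim.Build k V (inhabited_witness (svalP (cid h)))).

Lemma lfun_exists (V W : vectType k) (f : V -> W) :
  linear f -> exists g : 'Hom(V, W), forall v, g v = f v.
Proof.
move=> lf; pose L := GRing.isLinear.Build k V W *:%R f lf.
pose fL : {linear V -> W} := HB.pack f L.
by exists (linfun fL) => v; rewrite lfunE.
Qed.

End VectorStructures.

Section PresentableObjects.
Variables (k : fieldType) (A : lincat k).
Hypothesis hA : finitary_cat A.
Local Notation B := (abar A).
Variable Q : B.

Definition hom_vect (M : B) : vectType k := vect_of (abar_fin_dim hA Q M).

(** The product is reversed, so that precomposition makes $\mathrm{Hom}(Q,M)$ a left module. *)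
Definition end_alg : fdalg k.
Proof.
apply: (@FdAlg k (hom_vect Q) (idm Q) (fun a b => (b : hom Q Q) \c a)).
- by move=> a b c; rewrite mcompA.
- by move=> a; rewrite mcompm1.
- by move=> a; rewrite mcomp1m.
- by move=> b c u v; exact: mcomp_linr.
- by move=> a c u v; exact: mcomp_linl.
Defined.

Definition hom_mod (M : B) : fdmod end_alg.
Proof.
apply: (@FdMod k end_alg (hom_vect M) (fun a v => (v : hom Q M) \c (a : hom Q Q))).
- by move=> v c a b; exact: mcomp_linr.
- by move=> a c u v; exact: mcomp_linl.
- by move=> v; exact: mcompm1.
- by move=> a b v; exact: mcompA.
Defined.

Lemma mod_hom_ext (E : fdalg k) (V W : fdmod E) (f g : mod_hom V W) :
  (forall v, lval f v = lval g v) -> f = g.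
Proof. by move=> fg; apply/val_inj/lfunP. Qed.

Lemma mod_homZD (E : fdalg k) (V W : fdmod E) c (f g : mod_hom V W) v :
  lval (c *: f + g) v = c *: lval f v + lval g v.
Proof.
have -> : lval (c *: f + g) = c *: lval f + lval g by [].
by rewrite add_lfunE scale_lfunE.
Qed.

Lemma mod_hom_linear (E : fdalg k) (V W : fdmod E) (f : mod_hom V W) :
  linear (fun v => lval f v).
Proof. by move=> c u v; rewrite linearP. Qed.

Section ModHomOf.
Variables (E : fdalg k) (V W : fdmod E) (f : V -> W).
Hypotheses (lf : linear f) (ef : forall a v, f (act a v) = act a (f v)).

Definition lfun_of : 'Hom(V, W) := sval (cid (lfun_exists lf)).

Lemma lfun_ofE v : lfun_of v = f v.
Proof. exact: (svalP (cid (lfun_exists lf))). Qed.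

Fact lfun_of_equivariant : mod_equivariant lfun_of.
Proof. by move=> a v; rewrite !lfun_ofE. Qed.

Definition mod_hom_of : mod_hom V W := ModHom lfun_of_equivariant.

Lemma mod_hom_ofE v : lval mod_hom_of v = f v.
Proof. exact: lfun_ofE. Qed.

End ModHomOf.

Definition hom_mod_map (M N : B) (f : hom M N) : mod_hom (hom_mod M) (hom_mod N) :=
  @mod_hom_of _ (hom_mod M) (hom_mod N) (fun v => f \c (v : hom Q M))
    (mcomp_linr f) (fun a v => mcompA f v a).

(** Convertible with [has_resolution], but stated without a 2-category. *)
Definition presentable (M : B) := exists (X1 X0 : B) (d : hom X1 X0) (p : hom X0 M),
  [/\ in_add Q X1, in_add Q X0, exact_at d p & epi p].

Lemma hom_mod_mapE (M N : B) (f : hom M N) (v : hom Q M) :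
  lval (hom_mod_map f) v = f \c v.
Proof. exact: mod_hom_ofE. Qed.

Lemma hom_mod_map_linear (M N : B) : linear (@hom_mod_map M N).
Proof.
move=> c f g; apply: mod_hom_ext => v.
exact: (etrans (hom_mod_mapE _ v) (etrans (mcomp_linl v c f g)
  (esym (etrans (mod_homZD c _ _ v)
    (congr2 (fun a b => c *: a + b) (hom_mod_mapE f v) (hom_mod_mapE g v)))))).
Qed.

Lemma hom_mod_map1 (M : B) :
  hom_mod_map (idm M) = ModHom (@mod_id_subproof _ _ (hom_mod M)).
Proof.
apply: mod_hom_ext => v.
exact: (etrans (hom_mod_mapE _ v) (etrans (mcomp1m (v : hom Q M)) (esym (id_lfunE v)))).
Qed.

Lemma hom_mod_mapM (M N K : B) (g : hom N K) (f : hom M N) :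
  hom_mod_map (g \c f) = ModHom (mod_comp_subproof (hom_mod_map g) (hom_mod_map f)).
Proof.
apply: mod_hom_ext => v.
have e := comp_lfunE (lval (hom_mod_map g)) (lval (hom_mod_map f)) v.
apply: (etrans (hom_mod_mapE _ v)); apply: (etrans _ (esym e)).
apply: (etrans _ (esym (hom_mod_mapE g _))).
apply: (etrans _ (congr1 (mcomp g) (esym (hom_mod_mapE f v)))).
exact: (esym (mcompA g f v)).
Qed.

Definition hom_functor : functor (full_sub presentable) (modcat end_alg) :=
  @Functor k (full_sub presentable) (modcat end_alg)
    (fun M => hom_mod (sval M)) (fun M N f => hom_mod_map f)
    (fun M N => @hom_mod_map_linear (sval M) (sval N))
    (fun M => hom_mod_map1 (sval M))
    (fun M N K g f => hom_mod_mapM g f).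

Lemma hom_mod_map_inj (M N : B) (f g : hom M N) :
  presentable M -> hom_mod_map f = hom_mod_map g -> f = g.
Proof.
move=> [X1 [X0 [d [p [_ /(in_addP hA) tX0 _ ep]]]]] fg.
have e (v : hom Q M) : f \c v = g \c v.
  exact: (etrans (esym (hom_mod_mapE f v))
    (etrans (congr1 (fun h : mod_hom (hom_mod M) (hom_mod N) => lval h v) fg)
      (hom_mod_mapE g v))).
apply: ep; rewrite -[f \c p]mcompm1 -[g \c p]mcompm1.
apply: (thru_sep tX0) => t w tQ; case: _ / (esym tQ) w => w.
by rewrite -!mcompA e.
Qed.

(* Exactness of [Hom(Q, -)] on presentations by [add Q]. *)
Hypothesis lifting : forall (X1 X0 M : B) (d : hom X1 X0) (p : hom X0 M),
  thru (fun Y => Y = Q) (idm X0) -> is_cokernel d p ->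
  thru (fun Y => Y = Q) (idm X1) ->
  (forall f : hom Q M, exists w, f = p \c w) /\
  (forall w : hom Q X0, p \c w = 0 -> exists g, w = d \c g).

(** Writing the identity of [X0] as a sum of composites through [Q] dictates the map [f0] on [X0].
    It kills [d], as can be tested on maps from [Q] because [X1] is in $\mathrm{add}(Q)$, and so
    descends to [M]. *)
Lemma hom_mod_map_surj (M N : B) (h : mod_hom (hom_mod M) (hom_mod N)) :
  presentable M -> exists f, hom_mod_map f = h.
Proof.
move=> [X1 [X0 [d [p [/(in_addP hA) tX1 /(in_addP hA) tX0 ex ep]]]]].
have cok : is_cokernel d p by apply/(resolution_cokernel hA).
pose t (v : hom Q M) : hom Q N := lval h v.
have tl : linear t by exact: (mod_hom_linear h).
have te v (a : hom Q Q) : t (v \c a) = t v \c a by exact: (mod_homP h a v).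
have [n [g [q gq]]] := thru_eqP tX0.
pose f0 := \sum_a t (p \c g a) \c q a.
have f0E w : f0 \c w = t (p \c w).
  rewrite comp_suml -{2}[w]mcomp1m gq comp_suml comp_sumr (lin_sum tl).
  by apply: eq_bigr => a _; rewrite -!mcompA (mcompA p) te.
have [pd cokU] := cok; have [|f [fp _]] := cokU _ f0.
  rewrite -[_ \c d]mcompm1 -[0](comp0m _ (idm X1)); apply: (thru_sep tX1).
  move=> z w zQ; case: _ / (esym zQ) w => w.
  by rewrite -mcompA f0E mcompA pd comp0m comp0m (lin0 tl).
exists f; apply: mod_hom_ext => v; apply: (etrans (hom_mod_mapE f v)).
have [lift _] := lifting tX0 cok tX1; have [w vE] := lift v.
by rewrite [X in f \c X]vE mcompA fp f0E -vE.
Qed.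

(** A basis of [N] gives a surjection [ev] from $\mathrm{Hom}(Q,Q^n)$ to [N]; a finite spanning
    family of its kernel gives $d:Q^r\to Q^n$. By lifting, $\mathrm{Hom}(Q,-)$ of the cokernel of
    [d] is [N]. *)
Lemma hom_mod_essentially_surjective (N : fdmod end_alg) :
  exists M : B, presentable M /\
    exists (f : mod_hom (hom_mod M) N) (g : mod_hom N (hom_mod M)),
      (forall v, lval g (lval f v) = v) /\ (forall v, lval f (lval g v) = v).
Proof.
pose n := \dim {:N}; pose s (a : 'I_n) : N := (vbasis {:N})`_a.
have [X0 dX0] := abar_power hA Q n.
have tX0 : thru (fun Y => Y = Q) (idm X0).
  by apply: (thru_dsum dX0) => _; exact: thru_obj.
have [inj [prj [h1 h2 h3]]] := dX0.
pose ev (w : hom Q X0) : N := \sum_a act (prj a \c w : end_alg) (s a).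
have evl : linear ev.
  move=> c u v; rewrite scaler_sumr -big_split; apply: eq_bigr => a _ /=.
  by rewrite mcomp_linr; exact: act_linl.
have eva w (a : hom Q Q) : ev (w \c a) = act (a : end_alg) (ev w).
  rewrite /ev (lin_sum (@act_linr _ _ N a)); apply: eq_bigr => b _.
  by rewrite mcompA; exact: (@actM _ _ N a (prj b \c w)).
have evs v : exists w, ev w = v.
  exists (\sum_a coord (vbasis {:N}) a v *: inj a).
  rewrite {2}(coord_vbasis (memvf v)) (lin_comb evl); apply: eq_bigr => a _.
  congr (_ *: _); rewrite /ev (bigD1 a) //= h1 big1 ?addr0 => [|b ba].
    exact: (@act1 _ _ N).
  by rewrite h2 1?eq_sym //; exact: (lin0 (@act_linl _ _ N (s b))).
have K0 : ev 0 = 0 by exact: lin0.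
have KZD c u v : ev u = 0 -> ev v = 0 -> ev (c *: u + v) = 0.
  by move=> u0 v0; rewrite evl u0 v0 scaler0 addr0.
have [m [e eS]] := fin_dim_spans (abar_fin_dim hA Q X0).
have [r [w [w0 wS]]] := sub_spans (U := Submod K0 KZD) (fun v _ => eS v I).
have [X1 dX1] := abar_power hA Q r.
have tX1 : thru (fun Y => Y = Q) (idm X1).
  by apply: (thru_dsum dX1) => _; exact: thru_obj.
have [inj' [prj' [h1' h2' h3']]] := dX1.
pose d := \sum_a w a \c prj' a.
have dw a : d \c inj' a = w a.
  rewrite comp_suml (bigD1 a) //= -mcompA h1' mcompm1 big1 ?addr0 // => b ba.
  by rewrite -mcompA h2' 1?eq_sym // compm0.
have [M [p [cok _]]] := cokernel_exists hA d.
have [lift lift0] := lifting tX0 cok tX1; have [pd _] := cok.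
have pev u : p \c u = 0 <-> ev u = 0.
  split=> [/lift0[g ->]|/wS[c ->]].
    rewrite comp_suml (lin_sum evl) big1 // => a _.
    by rewrite -mcompA eva w0; exact: (lin0 (@act_linr _ _ N _)).
  rewrite comp_sumr big1 // => a _.
  by rewrite compZr -dw mcompA pd comp0m scaler0.
have pev2 u v : p \c u = p \c v <-> ev u = ev v.
  have E : ev (u - v) = ev u - ev v by rewrite -scaleN1r addrC evl scaleN1r addrC.
  split=> /eqP; rewrite -subr_eq0.
    by rewrite -mcompBr => /eqP/pev; rewrite E => /eqP; rewrite subr_eq0 => /eqP.
  by rewrite -E => /eqP/pev; rewrite mcompBr => /eqP; rewrite subr_eq0 => /eqP.
exists M; split.
  exists X1, X0, d, p; have [ex ep] := (resolution_cokernel hA d p).2 cok.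
  by split=> //; apply/(in_addP hA).
pose l (v : hom Q M) := sval (cid (lift v)).
have lE v : v = p \c l v := svalP (cid (lift v)).
pose r' (v : N) := sval (cid (evs v)).
have rE v : ev (r' v) = v := svalP (cid (evs v)).
pose f (v : hom Q M) := ev (l v).
pose g (v : N) := p \c r' v.
have fp u : f (p \c u) = ev u by apply/pev2; rewrite -lE.
have gev u : g (ev u) = p \c u by apply/pev2; rewrite rE.
have fl : linear f by move=> c u v; rewrite (lE u) (lE v) -mcomp_linr !fp evl.
have gl : linear g.
  by move=> c u v; rewrite -(rE u) -(rE v) -evl !gev mcomp_linr.
have fe (a : hom Q Q) v : f (v \c a) = act (a : end_alg) (f v).
  by rewrite (lE v) -mcompA !fp eva.
have ge (a : end_alg) v : g (act a v) = g v \c (a : hom Q Q).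
  by rewrite -(rE v) -eva !gev mcompA.
exists (@mod_hom_of _ (hom_mod M) N f fl fe), (@mod_hom_of _ N (hom_mod M) g gl ge).
split=> v.
  apply: (etrans (mod_hom_ofE _ _ _)).
  apply: (etrans (congr1 g (@mod_hom_ofE _ (hom_mod M) N _ _ _ _))).
  by rewrite (lE v) fp gev.
apply: (etrans (mod_hom_ofE _ _ _)).
apply: (etrans (congr1 f (@mod_hom_ofE _ N (hom_mod M) _ _ _ _))).
by rewrite -(rE v) gev fp.
Qed.

Lemma presentable_module_category : module_category_like (full_sub presentable).
Proof.
exists end_alg; apply: (@ff_surj_equivalent _ _ _ hom_functor).
- by move=> [M hM] [N hN] f g; exact: hom_mod_map_inj.
- by move=> [M hM] [N hN] h; exact: hom_mod_map_surj.
- move=> N; have [M [hM [f [g [gf fg]]]]] := hom_mod_essentially_surjective N.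
  exists (exist _ M hM); exists f, g; split; apply: mod_hom_ext => v.
    exact: (etrans (comp_lfunE _ _ v) (etrans (gf v) (esym (id_lfunE v)))).
  exact: (etrans (comp_lfunE _ _ v) (etrans (fg v) (esym (id_lfunE v)))).
Qed.

End PresentableObjects.

(** * The principal 2-representation *)

Section PrincipalAction.
Variables (k : fieldType) (C : twocat k) (star : involution C).
Variables (hC : fiat star) (i : C).
Local Notation P := (principal i).
Local Notation pmap g := (@pcl _ _ _ (Proj _) g).

Let finC (j l : C) : finitary_cat (C j l). Proof. by have [[_ h _] _] := hC. Qed.

Lemma act_left_adj (j l : C) (F : C j l) : is_adj (tf1 P F) (tf1 P (inv star F)).
Proof.
have [_ /(_ j l F)[alpha [beta adj]]] := hC.
exact: afun_adj (lcomp_adj i adj).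
Qed.

Lemma act_right_adj (j l : C) (F : C j l) : is_adj (tf1 P (inv star F)) (tf1 P F).
Proof.
have [f [fe ef]] := inv_eta_iso star F.
apply: (@adj_iso_right _ _ _ _ _ (act_left_adj (inv star F)) _ (tf2 (t:=P) f)
  (tf2 (t:=P) (inv_eta star F))).
- exact: tf2_nat.
- by move=> X; rewrite -tf2_comp ef tf2_id.
- by move=> X; rewrite -tf2_comp fe tf2_id.
Qed.

Lemma act_Proj (j l : C) (F : C j l) (E : C i j) :
  isomorphic (tf1 P F (Proj E)) (Proj (F \o1 E) : P l).
Proof. exact: (@afun_Proj _ _ _ (lcomp i F)). Qed.

Lemma act_retract (j l : C) (F G : C j l) X :
  retract F G -> retract (tf1 P F X) (tf1 P G X).
Proof.
by move=> [a [b ba]]; exists (tf2 a X), (tf2 b X); rewrite -tf2_comp ba tf2_id.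
Qed.

Lemma thru_kill (A : lincat k) (T : A -> Prop) (X : abar A) :
  (forall z (h : hom (Proj z : abar A) X), T z -> h = 0) ->
  forall x y (g : hom x y), thru T g ->
  forall f : hom (Proj y : abar A) X, f \c pmap g = 0.
Proof.
move=> TX x y g; elim=> {x y g} [x y|x y g h _ IH _ IH'|x z y g h Tz] f.
- by rewrite pcl0 compm0.
- by rewrite (linD (@pcl_linear _ _ _ (Proj _))) compDr IH IH' addr0.
- have -> : pmap (g \c h) = pmap g \c pmap h :> hom (Proj x : abar A) (Proj y).
    by rewrite pcl_comp.
  by rewrite mcompA (TX z (f \c pmap g) Tz) comp0m.
Qed.

Lemma nonzero_indecomposable (j : C) (E : C i j) (X : P j)
    (f : hom (Proj E : P j) X) : f <> 0 ->
  exists D, [/\ indecomposable D, retract D E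
    & exists h : hom (Proj D : P j) X, h <> 0].
Proof.
move=> f0; apply: contrapT => nD; apply: f0.
have fdA : forall x y : C i j, fin_dim (hom x y) by have [_ h _] := finC i j.
rewrite -[f]mcompm1 -(pcl_id (finC i j)).
apply: thru_kill (thru_indecomposable fdA E) f => z h [zi zE].
by apply: contrapT => h0; apply: nD; exists z; split=> //; exists h.
Qed.

(* A nonzero [F X] is detected by a nonzero morphism [P_E -> F X], which *)
(* transposes to [P_{F^* E} -> X].                                       *)
Lemma act_nonzero (j l : C) (F : C j l) (X : P j) : ~ is_zero (tf1 P F X) ->
  exists (E : C i l) (f : hom (Proj (inv star F \o1 E) : P j) X), f <> 0.
Proof.
move=> FX0; pose E := atgt (tf1 P F X : abar (C i l)).
have c0 : cov (tf1 P F X : abar (C i l)) <> 0.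
  by move/(epi0 (@cov_epi _ _ (tf1 P F X : abar (C i l)))).
have [g g0] := adj_nonzero_l (act_right_adj F) c0.
have [t [t' [t't tt']]] := act_Proj (inv star F) E.
exists E, (g \c t') => gt0; apply: g0.
by rewrite -[g]mcompm1 -t't mcompA gt0 comp0m.
Qed.

Lemma act_nonzero_hom (j l : C) (F : C j l) (X : P j) (E : C i l)
    (f : hom (Proj (inv star F \o1 E) : P j) X) : f <> 0 -> ~ is_zero (tf1 P F X).
Proof.
move=> f0 FX0; have [t [t' [t't tt']]] := act_Proj (inv star F) E.
have ft0 : f \c t <> 0.
  by move=> e; apply: f0; rewrite -[f]mcompm1 -tt' mcompA e comp0m.
have [g] := adj_nonzero_r (act_right_adj F) ft0.
by apply; exact: zero_to.
Qed.

Lemma act_zero_of_simple (j l : C) (F : C j l) (Y : P j) :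
  (forall X : P j, simple X -> subquotient X Y -> is_zero (tf1 P F X)) ->
  is_zero (tf1 P F Y).
Proof.
move=> sY; apply: contrapT => /act_nonzero[E [f f0]].
have [D [Di [a [b ba]] [h h0]]] := nonzero_indecomposable f0.
have hA := finC i j.
have [I [q [u [eq mu hE]]]] := image_exists hA h.
have I0 : ~ is_zero I by move=> z; apply: h0; rewrite hE (zero_to q z) compm0.
have [L [r [sL er]]] := simple_quotient hA Di eq I0.
have LY : subquotient L Y by exists I, u, r.
apply: (act_nonzero_hom (F := F) (E := E) (f := (r \c q) \c pmap b)) (sY L sL LY).
move=> rqb; case: sL => + _; apply; apply: (epi0 (epi_comp er eq)).
rewrite -[r \c q]mcompm1 -(pcl_id hA) -ba.
have -> : pmap (b \c a) = pmap b \c pmap a :> hom (Proj D : P j) (Proj D).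
  by rewrite pcl_comp.
by rewrite mcompA rqb comp0m.
Qed.

End PrincipalAction.

(** * The cell 2-representation *)

Section RightOrder.
Variables (k : fieldType) (C : twocat k) (S : indecs C).
Hypothesis finC : forall i j : C, finitary_cat (C i j).

(** Inversion of the indexed family; the sources agree only propositionally, whence the transport
    along [e]. *)
Lemma le_right_elim (x y : indec1 S) : le_right x y ->
  exists (e : i_src x = i_src y) (H : C (i_tgt x) (i_tgt y)),
    retract (S _ _ (i_idx y))
      (H \o1 S _ _ (match e in _ = z return idx S z (i_tgt x) with
        | erefl => i_idx x end)).
Proof. by case=> i j l a b H /summand_retract r; exists erefl, H. Qed.

Lemma le_rightP (i j l : C) (a : idx S i j) (b : idx S i l) :
  le_right (Indec1 a) (Indec1 b) <-> exists H : C j l, retract (S i l b) (H \o1 S i j a).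
Proof.
split=> [/le_right_elim[e [H]]|[H r]] /=.
  by rewrite (Prop_irrelevance e erefl); exists H.
apply: LeRight (H) _; apply: retract_summand r.
by have [[_ _ sp] _ _] := finC i l.
Qed.

Lemma comp1_retract (i j l : C) (H : C j l) (F G : C i j) :
  retract F G -> retract (H \o1 F) (H \o1 G).
Proof. exact: (@fmap_retract _ _ _ (lcomp i H)). Qed.

Lemma le_right_trans (x y z : indec1 S) : le_right x y -> le_right y z -> le_right x z.
Proof.
case: x y z => [i j a] [i2 l b] [i3 m c] xy yz.
have [/= e _] := le_right_elim xy; case: _ / e b xy yz => b.
move=> xy yz; have [/= e _] := le_right_elim yz; case: _ / e c yz => c.
move=> /le_rightP[H' r'].
have [H r] := (le_rightP a b).1 xy; apply/le_rightP; exists (H' \o1 H).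
by rewrite -comp1A; apply: (retract_trans r'); exact: comp1_retract.
Qed.

End RightOrder.

Lemma thru_factor (k : fieldType) (B : lincat k) (T : B -> Prop) (W V x y : B)
    (p : hom W V) (f : hom x y) (w : hom W x) :
  thru T f -> (forall z, T z -> forall v : hom W z, exists h, v = h \c p) ->
  exists h, f \c w = h \c p.
Proof.
move=> tf Tp; elim: tf w => {x y f} [x y|x y f g _ IH _ IH'|x z y f g Tz] w.
- by exists 0; rewrite !comp0m.
- have [h hE] := IH w; have [h' hE'] := IH' w; exists (h + h').
  by rewrite !compDl hE hE'.
- have [h hE] := Tp z Tz (g \c w); exists (f \c h).
  by rewrite -mcompA hE mcompA.
Qed.

Lemma thru_tf2 (k : fieldType) (C : twocat k) (M : twofunctor C) (i j : C)
    (T : C i j -> Prop) (T' : M j -> Prop) (X : M i) (F G : C i j) (a : hom F G) :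
  (forall D, T D -> thru T' (idm (tf1 M D X))) -> thru T a -> thru T' (tf2 a X).
Proof.
move=> TT'; elim=> {F G a} [F G|F G a b _ ta _ tb|F D G a b TD].
- have := tf2_lin (t := M) (-1) (0 : hom F G) 0 X.
  by rewrite scaler0 addr0 scaleN1r addNr => ->; exact: thru0.
- have := tf2_lin (t := M) 1 a b X; rewrite !scale1r => ->; exact: thruD.
- rewrite tf2_comp -[tf2 a X]mcompm1; apply: thru_r; apply: thru_l; exact: TT'.
Qed.

(** * The action of the cell on the simple object [L] *)

Section CellModule.
Variables (k : fieldType) (C : twocat k) (star : involution C) (hC : fiat star).
Variables (S : indecs C) (i : C) (R : set (indec1 S)) (hR : right_cell R).
Local Notation P := (principal i).
Local Notation pmap g := (@pcl _ _ _ (Proj _) g).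
Local Notation cell j := (cell_part R i j).
Local Notation rep1 a := (S i _ (sval a)).

Let finC (j l : C) : finitary_cat (C j l). Proof. by have [[_ h _] _] := hC. Qed.
Let fdA (j l : C) : forall x y : C j l, fin_dim (hom x y).
Proof. by have [_ h _] := finC j l. Qed.

Variables (G : idx S i i) (K Y L : P i).
Variables (u : hom K (Proj (one1 i) : P i)) (q : hom (Proj (one1 i) : P i) Y).
Variables (kap : hom K L) (pG : hom (Proj (S i i G) : P i) L).
Hypotheses (mono_u : mono u) (cok_q : is_cokernel u q).
Hypothesis Y_killed : forall X : P i, simple X -> subquotient X Y ->
  forall j (a : cell j), is_zero (cell_act X a).
Hypotheses (simple_L : simple L) (epi_kap : epi kap) (epi_pG : epi pG).
Hypothesis L_alive : forall j (a : cell j), ~ is_zero (cell_act L a).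

Lemma cellP j l (a : cell j) (b : idx S i l) :
  le_right (Indec1 (sval a)) (Indec1 b) ->
  le_right (Indec1 b) (Indec1 (sval a)) -> exists b' : cell l, sval b' = b.
Proof.
move=> ab ba; have Rb : R (Indec1 b).
  have [x Rx] := hR.
  have inR z : R z <-> le_right x z /\ le_right z x by rewrite Rx.
  have /inR[xa ax] := asboolW (svalP a).
  by apply/inR; split; apply: (le_right_trans finC); eauto.
by exists (exist _ b (asboolT Rb)).
Qed.

(** Being above the cell in the right order, with decomposable [D] allowed so that the notion is
    closed under left composition. *)
Definition above j (D : C i j) :=
  exists l (a : cell l) (H : C l j), retract D (H \o1 rep1 a).

Lemma above_retract j (D D' : C i j) : retract D' D -> above D -> above D'.
Proof. by move=> D'D [l [a [H r]]]; exists l, a, H; exact: retract_trans r. Qed.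

Lemma above_comp j l (H : C j l) (D : C i j) : above D -> above (H \o1 D).
Proof.
move=> [m [a [H' r]]]; exists m, a, (H \o1 H').
by rewrite -comp1A; exact: comp1_retract.
Qed.

Lemma above_cell j (a : cell j) : above (rep1 a).
Proof.
exists j, a, (one1 j); rewrite comp1_1l.
by apply: isomorphic_retract; exists (idm _); exact: iso_id.
Qed.

Lemma above_kills_Y j (D : C i j) : above D -> is_zero (tf1 P D Y).
Proof.
move=> [l [a [H r]]]; apply: (act_zero_of_simple hC) => X sX XY.
apply: (retract_zero (act_retract X r)).
have -> : tf1 P (H \o1 rep1 a) X = tf1 P H (tf1 P (rep1 a) X).
  exact: (tf1_comp (t := P)).
by apply: fmap_zero; exact: (Y_killed sX XY a).
Qed.

Lemma act_one j (D : C i j) : isomorphic (tf1 P D (Proj (one1 i))) (Proj D : P j).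
Proof. by have := act_Proj hC D (one1 i); rewrite comp1_1r. Qed.

(** Apply [D] to $K\to P_{\mathbf 1}\to Y$: the first map stays mono because [D] is a right adjoint,
    and it becomes epi because $DY=0$. Finally $DP_{\mathbf 1}\cong P_D$. *)
Lemma above_K j (D : C i j) : above D -> isomorphic (tf1 P D K) (Proj D : P j).
Proof.
move=> aD; apply: isomorphic_trans (act_one D); exists (fmap (tf1 P D) u).
apply: (mono_epi_iso (finC i j)).
  exact: (adj_mono (act_right_adj hC i D) mono_u).
have cok := adj_cokernel (act_left_adj hC i D) cok_q.
have [_ ex] := cokernel_elex (finC i j) cok.
apply: lift_epi => F y; apply: ex.
by rewrite (zero_to (fmap (tf1 P D) q) (above_kills_Y aD)) comp0m.
Qed.

(** Both $P_D$ and $P_G$ map onto the simple [L]. Lifting each map through the other gives an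
    endomorphism of $P_G$ that fixes [pG], hence is invertible. *)
Lemma nonzero_to_L (D : C i i) (h : hom (Proj D : P i) L) :
  indecomposable D -> h <> 0 -> retract (S i i G) D.
Proof.
move=> Di h0; have hA := finC i i.
have eh := simple_epi hA simple_L h0.
have [s sE] := epi_lift hA pG eh; have [t tE] := epi_lift hA h epi_pG.
have GG : pG \c (t \c s) = pG by rewrite mcompA -tE -sE.
have PGi := Proj_indecomposable hA (rep_indec G).
have pG0 : pG <> 0 by move/(epi0 epi_pG); case: simple_L.
have [v [vts _]] := fix_iso (abar_split hA) (abar_fin_dim hA) PGi pG0 GG.
by apply/(Proj_retract hA); exists s, (v \c t); rewrite -mcompA.
Qed.

Lemma act_kap_epi j (D : C i j) : epi (fmap (tf1 P D) kap).
Proof. exact: (adj_epi (act_left_adj hC i D) epi_kap). Qed.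

(** The epimorphism $P_D\cong DK\to DL$ transposes to a nonzero map $P_{D^{*}D}\to L$, to which
    [nonzero_to_L] applies on an indecomposable retract. *)
Lemma above_alive j (D : C i j) : above D -> ~ is_zero (tf1 P D L) ->
  retract (S i i G) (inv star D \o1 D).
Proof.
move=> aD DL0; have [v vi] := isomorphic_sym (above_K aD).
pose r := fmap (tf1 P D) kap \c v.
have r0 : r <> 0.
  by move/(epi0 (epi_comp (act_kap_epi (D := D)) (iso_epi vi))).
have [f f0] := adj_nonzero_l (act_right_adj hC i D) r0.
have [t [t' [t't tt']]] := act_Proj hC (inv star D) D.
have ft0 : f \c t' <> 0.
  by move=> e; apply: f0; rewrite -[f]mcompm1 -t't mcompA e comp0m.
have [D' [D'i D'r [h h0]]] := nonzero_indecomposable hC ft0.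
exact: retract_trans (nonzero_to_L D'i h0) D'r.
Qed.

Lemma cell_le_G j (a : cell j) : le_right (Indec1 (sval a)) (Indec1 G).
Proof.
apply/(le_rightP finC); exists (inv star (rep1 a)).
by apply: above_alive; [exact: above_cell | exact: L_alive].
Qed.

(** Both $P_D$ and $P_{DG}$ map onto $DL$. Projectivity gives [s] from $P_D$ to $P_{DG}$, and a lift
    of [pG] through [kap] gives [w] back, both over $DL$; so [w \c s] fixes the nonzero [r] and is
    invertible. *)
Lemma G_le_cell j (a : cell j) : le_right (Indec1 G) (Indec1 (sval a)).
Proof.
apply/(le_rightP finC); set D := rep1 a; exists D; have hA := finC i j.
have [v [v' [v'v vv']]] := isomorphic_sym (above_K (above_cell a)).
have vi : is_iso v by exists v'.
pose r := fmap (tf1 P D) kap \c v.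
have er : epi r := epi_comp (act_kap_epi (D := D)) (iso_epi vi).
have r0 : r <> 0 by move/(epi0 er); exact: L_alive.
have [g gE] := epi_lift (finC i i) pG epi_kap.
have [t [t' [t't tt']]] := act_Proj hC D (S i i G).
have ti : is_iso t' by exists t.
have eD : epi (fmap (tf1 P D) pG \c t').
  by apply: epi_comp (iso_epi ti); exact: (adj_epi (act_left_adj hC i D) epi_pG).
have [s sE] := epi_lift hA r eD.
pose w := v' \c fmap (tf1 P D) g \c t'.
have rw : r \c (w \c s) = r.
  rewrite [RHS]sE gE fmapM /r /w -!mcompA (mcompA v) vv' mcomp1m.
  by [].
have PDi := Proj_indecomposable hA (rep_indec (sval a)).
have [x [xws _]] := fix_iso (abar_split hA) (abar_fin_dim hA) PDi r0 rw.
by apply/(Proj_retract hA); exists s, (x \c w); rewrite -mcompA.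
Qed.

Lemma G_cell j (a : cell j) : exists c : cell i, sval c = G.
Proof. exact: cellP (cell_le_G a) (G_le_cell a). Qed.

(** If $DL\neq0$, then [D] is squeezed into the cell by $F_a\leq_R D\leq_R G\leq_R F_a$. *)
Lemma above_cell_or_zero j (D : C i j) : above D -> indecomposable D ->
  is_zero (tf1 P D L) \/ exists a : cell j, isomorphic D (rep1 a).
Proof.
move=> aD Di; case: (pselect (is_zero (tf1 P D L))) => DL; [by left | right].
have [b Db] := rep_surj S Di.
have [l [a [H r]]] := aD.
have ab : le_right (Indec1 (sval a)) (Indec1 b).
  apply/(le_rightP finC); exists H; apply: (retract_trans _ r).
  exact/isomorphic_retract/isomorphic_sym.
have bG : le_right (Indec1 b) (Indec1 G).
  apply/(le_rightP finC); exists (inv star D).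
  apply: (retract_trans (above_alive aD DL)); apply: comp1_retract.
  exact: isomorphic_retract.
have [b' b'E] := cellP ab (le_right_trans finC bG (G_le_cell a)).
by exists b'; rewrite b'E.
Qed.

(** A nonzero [f] makes [G] a retract of [D], so $DL\neq0$. If [f] did not kill some [x] in the
    kernel of $P_D\to DL$, the composite would be onto the simple [L]; lifting through it would make
    [x] a split epimorphism and force $DL=0$. *)
Lemma factor_indecomposable (D : C i i) (f : hom (tf1 P D K) L) :
  above D -> indecomposable D -> exists g, f = g \c fmap (tf1 P D) kap.
Proof.
move=> aD Di; have hA := finC i i.
case: (pselect (f = 0)) => [->|f0]; first by exists 0; rewrite comp0m.
have [v vi] := isomorphic_sym (above_K aD); have [v' [v'v vv']] := vi.
have fv0 : f \c v <> 0.
  by move=> e; apply: f0; rewrite -[f]mcompm1 -vv' mcompA e comp0m.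
have DL0 : ~ is_zero (tf1 P D L).
  have [l [a _]] := aD; have [c cG] := G_cell a.
  move=> DL0; apply: (@L_alive i c); apply: (retract_zero _ DL0).
  by apply: act_retract; rewrite cG; exact: nonzero_to_L fv0.
have er := epi_comp (act_kap_epi (D := D)) (iso_epi vi).
have [|g gE] := @epi_factor _ _ hA _ _ _ _ (f \c v) er.
  move=> F x rx; apply: contrapT => fx0.
  have efx := simple_epi hA simple_L fx0.
  have [y yE] := epi_lift hA (f \c v) efx.
  have fxy : (f \c v) \c (x \c y) = f \c v by rewrite mcompA -yE.
  have PDi := Proj_indecomposable hA Di.
  have [z [_ xyz]] := fix_iso (abar_split hA) (abar_fin_dim hA) PDi fv0 fxy.
  apply: DL0; apply: (epi0 er).
  have e : (fmap (tf1 P D) kap \c v) \c ((x \c y) \c z) = 0.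
    by rewrite -(mcompA x) (mcompA (_ \c v) x) rx comp0m.
  by rewrite xyz mcompm1 in e.
by exists g; rewrite -[f]mcompm1 -vv' mcompA gE -!mcompA vv' mcompm1.
Qed.

Lemma factor_above (T : C i i) (f : hom (tf1 P T K) L) :
  above T -> exists g, f = g \c fmap (tf1 P T) kap.
Proof.
move=> aT.
suff z (T1 T2 : C i i) (a : hom T1 T2) :
    thru (fun D => indecomposable D /\ retract D T) a ->
    forall f : hom (tf1 P T2 K) L, exists g, f \c tf2 a K = g \c fmap (tf1 P T1) kap.
  have [g] := z _ _ _ (thru_indecomposable (@fdA i i) T) f.
  by rewrite tf2_id mcompm1 => ->; exists g.
elim=> {T1 T2 a f} [x y|x y a b _ IH _ IH'|x D y a b [Di DT]] f.
- exists 0; have := tf2_lin (t := P) (-1) (0 : hom x y) 0 K.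
  by rewrite scaler0 addr0 scaleN1r addNr => ->; rewrite compm0 comp0m.
- have [g gE] := IH f; have [g' gE'] := IH' f; exists (g + g').
  have := tf2_lin (t := P) 1 a b K; rewrite !scale1r => ->.
  by rewrite compDr gE gE' compDl.
- have [g gE] := factor_indecomposable (f \c tf2 a K) (above_retract DT aT) Di.
  by exists (g \c tf2 b L); rewrite tf2_comp mcompA gE -!mcompA tf2_nat.
Qed.

(** Transposition along $F_b^{*}\dashv F_b$ moves the target to [L], where [factor_above] applies to
    $F_b^{*}F_a$; transposing back gives [g]. *)
Lemma factor_cell j (a b : cell j) (f : hom (cell_act K a) (cell_act L b)) :
  exists g, f = g \c fmap (tf1 P (rep1 a)) kap.
Proof.
pose Fs := inv star (rep1 b); pose F := rep1 b; pose Fa := rep1 a.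
have [eta [eps [ne nf t1 t2]]] := act_right_adj hC i F.
pose f' := eps L \c fmap (tf1 P Fs) f.
have [h hE] := factor_above (f' \c eqm (tf1_comp (t := P) Fs Fa K))
  (above_comp Fs (above_cell a)).
pose e (X : P i) : hom (tf1 P Fs (tf1 P Fa X)) (tf1 P (Fs \o1 Fa) X) :=
  eqm (esym (tf1_comp (t := P) Fs Fa X)).
have eK X : eqm (tf1_comp (t := P) Fs Fa X) \c e X = idm _.
  by rewrite /e; case: _ / (tf1_comp (t := P) Fs Fa X); rewrite /= mcomp1m.
have eK' X : e X \c eqm (tf1_comp (t := P) Fs Fa X) = idm _.
  by rewrite /e; case: _ / (tf1_comp (t := P) Fs Fa X); rewrite /= mcomp1m.
have f'E : f' = (h \c e L) \c fmap (tf1 P Fs) (fmap (tf1 P Fa) kap).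
  rewrite -[LHS]mcompm1 -(eK K) mcompA hE -[fmap (tf1 P (Fs \o1 Fa)) kap]mcomp1m.
  by rewrite -(eK' L) -(mcompA (e L)) tf1_compM -!mcompA eK mcompm1.
exists (fmap (tf1 P F) (h \c e L) \c eta (tf1 P Fa L)).
rewrite -mcompA ne mcompA -fmapM -f'E /f' fmapM -mcompA -ne mcompA t2 mcomp1m.
by [].
Qed.

Variables (Q : forall j, P j).
Hypothesis dsum_Q : forall j, is_dsum (fun a : cell j => cell_act L a) (Q j).

Lemma Q_thru j : thru (fun z => exists a : cell j, z = cell_act L a) (idm (Q j)).
Proof. by apply: (thru_dsum (dsum_Q j)) => a; apply: thru_obj; exists a. Qed.

Lemma Q_retract j (a : cell j) : retract (cell_act L a) (Q j).
Proof. exact: dsum_retract (dsum_Q j). Qed.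

Lemma factor_add j (a : cell j) (X : P j) (w : hom (cell_act K a) X) :
  thru (fun z => z = Q j) (idm X) -> exists h, w = h \c fmap (tf1 P (rep1 a)) kap.
Proof.
move=> tX; have {}tX : thru (fun z => exists b : cell j, z = cell_act L b) (idm X).
  by apply: thru_trans tX => z ->; exact: Q_thru.
have [|h] := thru_factor (p := fmap (tf1 P (rep1 a)) kap) w tX.
  by move=> z [b ->] v; exact: factor_cell.
by rewrite mcomp1m => ->; exists h.
Qed.

(** [cell_act K a] is projective by [above_K]. Only elements in the image of [f] need to lift, so
    the lemma serves both for epimorphisms and for exactness at a middle term. *)
Lemma lift_from_K j (a : cell j) (X Z : P j) (p : hom X Z)
    (f : hom (cell_act K a) Z) :
  (forall F (y : hom (Proj F : P j) Z),
    (exists g, y = f \c g) -> exists x, y = p \c x) ->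
  exists w, f = p \c w.
Proof.
move=> lp; have [v [v' [v'v vv']]] := isomorphic_sym (above_K (above_cell a)).
have [|x xE] := lp _ (f \c v); first by exists v.
by exists (x \c v'); rewrite mcompA -xE -mcompA vv' mcompm1.
Qed.

(** A map out of $F_aL$ is pulled back to the projective $F_aK$ and lifted there; the lift factors
    through $F_aL$ by [factor_add], and the epimorphism $F_aK\to F_aL$ cancels. *)
Lemma Q_lifting j (X1 X0 M : P j) (d : hom X1 X0) (p : hom X0 M) :
  thru (fun z => z = Q j) (idm X0) -> is_cokernel d p ->
  thru (fun z => z = Q j) (idm X1) ->
  (forall f : hom (Q j) M, exists w, f = p \c w) /\
  (forall w : hom (Q j) X0, p \c w = 0 -> exists g, w = d \c g).
Proof.
move=> tX0 cok tX1; have ep := cokernel_epi cok.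
have [pd ex] := cokernel_elex (finC i j) cok.
(* It suffices to lift on each summand of [Q j] separately. *)
have glue (X Z : P j) (f : hom X Z) (g : hom (Q j) Z) :
    (forall a : cell j, forall h : hom (cell_act L a) (Q j), exists w, g \c h = f \c w) ->
    exists w, g = f \c w.
  move=> gf; have [inj [prj [_ _ e]]] := dsum_Q j.
  pose w a := sval (cid (gf a (inj a))).
  have wE a : g \c inj a = f \c w a := svalP (cid (gf a (inj a))).
  exists (\sum_a w a \c prj a); rewrite -[LHS]mcompm1 -e !comp_sumr.
  by apply: eq_bigr => a _; rewrite !mcompA wE.
split=> [f|w pw]; apply: glue => a h.
  have [|w wE] := @lift_from_K j a _ _ p ((f \c h) \c fmap (tf1 P (rep1 a)) kap).
    by move=> F y _; have [x ->] := epi_lift (finC i j) y ep; exists x.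
  have [v vE] := factor_add w tX0; exists v.
  by apply: (act_kap_epi (D := rep1 a)); rewrite wE vE mcompA.
have [|x xE] := @lift_from_K j a _ _ d ((w \c h) \c fmap (tf1 P (rep1 a)) kap).
  by move=> F y [g ->]; apply: ex; rewrite !mcompA pw !comp0m.
have [v vE] := factor_add x tX1; exists v.
by apply: (act_kap_epi (D := rep1 a)); rewrite xE vE mcompA.
Qed.

(** Decompose [T]: each indecomposable retract sends [L] to zero or, by [above_cell_or_zero], to a
    summand of [Q j]. *)
Lemma act_above_add j (T : C i j) : above T ->
  thru (fun z => z = Q j) (idm (tf1 P T L)).
Proof.
move=> aT; rewrite -tf2_id.
apply: thru_tf2 (thru_indecomposable (@fdA i j) T) => D [Di DT].
have [DL0|[a Da]] := above_cell_or_zero (above_retract DT aT) Di.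
  by rewrite DL0; exact: thru0.
apply: (thru_retract (y := Q j)); last exact: thru_obj.
apply: retract_trans (Q_retract a); apply: act_retract.
exact: isomorphic_retract.
Qed.

Lemma resolution_stable : stable (fun j (M : P j) => has_resolution (Q j) M).
Proof.
move=> j l F M [X1 [X0 [d [p [a1 a0 ex ep]]]]].
have actQ (X : P j) : in_add (Q j) X -> in_add (Q l) (tf1 P F X).
  move=> /(in_addP (finC i j)) tX; apply/(in_addP (finC i l)).
  rewrite -fmap1; apply: thru_fmap tX => _ ->.
  rewrite -fmap1; apply: thru_fmap (Q_thru j) => _ [b ->].
  have -> : tf1 P F (cell_act L b) = tf1 P (F \o1 rep1 b) L by rewrite tf1_comp.
  exact/act_above_add/above_comp/above_cell.
have /(resolution_cokernel (finC i j)) cok := conj ex ep.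
have := adj_cokernel (act_left_adj hC i F) cok.
move=> /(resolution_cokernel (finC i l))[ex' ep'].
exists (tf1 P F X1), (tf1 P F X0), (fmap (tf1 P F) d), (fmap (tf1 P F) p).
by split=> //; exact: actQ.
Qed.

Lemma restriction_2representation : is_2representation (restrict resolution_stable).
Proof.
move=> j; apply: (presentable_module_category (finC i j) (Q := Q j)).
exact: Q_lifting.
Qed.

End CellModule.

Theorem theorem22 (k : closedFieldType) (C : twocat k) (star : involution C)
    (hC : fiat star) (S : indecs C) (i : C) (R : set (indec1 S))
    (hR : right_cell R) (hRi : exists (j : C) (a : idx S i j), R (Indec1 a))
    (G : idx S i i) (hG : is_G R G)
    (L : principal i i) (hL : is_simple_head (S i i G) L)
    (Q : forall j : C, principal i j)
    (hQ : forall j : C, is_dsum (fun a : cell_part R i j => cell_act L a) (Q j)) :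
  exists st : stable (fun j (M : principal i j) => has_resolution (Q j) M),
    is_2representation (restrict st).
Proof.
have [K [Y [L' [u [q [[mu cq] hY hL' hK alive]]]]]] := hG.
have [sL' [pG' [epG' _]]] := hL'; have [_ [n [r [p [_ cp]]]]] := hK.
have [sL [pG [epG uniq]]] := hL.
(* The head of $P_G$ is unique up to isomorphism, so the given [L] can take the place of the [L']
   supplied by [hG]. *)
have [v [[v' [v'v vv']] _]] := uniq L' pG' sL' epG'.
have ekap : epi (v' \c p).
  by apply: epi_comp (cokernel_epi cp); apply: iso_epi; exists v.
have aliveL j (a : cell_part R i j) : ~ is_zero (cell_act L a).
  move=> L0; apply: (alive j a); apply: retract_zero L0.
  by apply: fmap_retract; exists v', v.
by eexists; exact: (restriction_2representation hC hR mu cq hY sL ekap epG aliveL hQ).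
Qed.
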